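(* Let $P$ be a law on environments $\omega=(\omega_x)_{x\in\mathbb Z}$ such that: (i) under $P$ the $\omega_x$, $x\in\mathbb Z$, are i.i.d. and there is a constant $c>0$ with $P(\omega_x\in[c,1-c])=1$; (ii) $E_P[\log\rho_0]<0$; (iii) $P(\omega_0<1/2)>0$ and $P(\omega_0>1/2)>0$. Let $\kappa>0$ be the unique positive solution of $E_P[\rho_0^\kappa]=1$. Then for $P$-a.e. environment $\omega$, $$P_\omega(X_{2n}=0)=\exp\Big\{-n^{\frac{\kappa}{\kappa+1}+o(1)}\Big\}\qquad\text{as } n\to\infty,$$ that is, $\lim_{n\to\infty}\frac{\ln(-\ln P_\omega(X_{2n}=0))}{\ln n}=\frac{\kappa}{\kappa+1}$.
   Context: An environment is $\omega=(\omega_x)_{x\in\mathbb Z}\in(0,1)^{\mathbb Z}$; $P$ is a probability law on environments, with expectation $E_P$. Put $\rho_x=(1-\omega_x)/\omega_x$. Given $\omega$, the random walk in random environment $(X_n)_{n\ge0}$ is, under the quenched law $P_\omega$, the time-homogeneous Markov chain on $\mathbb Z$ with $X_0=0$ that from site $x$ jumps to $x+1$ with probability $\omega_x$ and to $x-1$ with probability $1-\omega_x$. Under (i)-(iii) the equation $E_P[\rho_0^\kappa]=1$ has a unique solution $\kappa>0$. The term $o(1)$ may depend on $\omega$. *)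

(* Defs.v *)
From HB Require Import structures.
From mathcomp Require Import all_boot all_order all_algebra finmap.
From mathcomp Require Import all_classical all_reals all_analysis.

Set Implicit Arguments.
Unset Strict Implicit.
Unset Printing Implicit Defensive.

Import Order.TTheory GRing.Theory Num.Theory.
Import numFieldNormedType.Exports.

Local Open Scope classical_set_scope.
Local Open Scope ring_scope.

Record environment (R : realType) := Environment {
  omega :> int -> R;
  omega_in01 : forall x, 0 < omega x < 1
}.

Section environment_instances.
Variable R : realType.

HB.instance Definition _ := gen_eqMixin (environment R).
HB.instance Definition _ := gen_choiceMixin (environment R).

Let half_in01 (x : int) : 0 < (2^-1 : R) < 1.
Proof. by rewrite invr_gt0 ltr0n invf_lt1 ?ltr1n ?ltr0n. Qed.

(* The point is required by measurableType; its choice is irrelevant. *)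
HB.instance Definition _ := isPointed.Build (environment R)
  (Environment half_in01).

End environment_instances.

Definition env_cylinders (R : realType) : set (set (environment R)) :=
  \bigcup_(x : int) preimage_set_system setT (fun w => omega w x) measurable.

(* (0,1)^Z with the product of the Borel sigma-algebras. *)
Definition env_space (R : realType) := g_sigma_algebraType (@env_cylinders R).

Definition trajectory := nat -> int.
HB.instance Definition _ := Choice.on trajectory.
HB.instance Definition _ := isPointed.Build trajectory (fun=> 0).

Definition traj_cylinders : set (set trajectory) :=
  \bigcup_(n : nat)
    preimage_set_system setT (fun X : trajectory => X n) [set: set int].

(* Z^N with the product of the discrete sigma-algebras. *)
Definition traj_space := g_sigma_algebraType traj_cylinders.

Section iid.
Context d (T : measurableType d) d' (T' : measurableType d') (R : realType).
Context (I : choiceType) (P : probability T R) (Y : I -> T -> T').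

Definition mutually_independent :=
  forall (J : {fset I}) (B : I -> set T'), (forall i, measurable (B i)) ->
    (P [set t | forall i, i \in J -> B i (Y i t)] =
     \prod_(i <- J) P [set t | B i (Y i t)])%E.

Definition identically_distributed :=
  forall (i j : I) (B : set T'), measurable B ->
    P [set t | B (Y i t)] = P [set t | B (Y j t)].

Definition iid := mutually_independent /\ identically_distributed.

End iid.

Definition rho (R : realType) (w : environment R) (x : int) : R :=
  (1 - w x) / w x.

Definition jump (R : realType) (w : environment R) (x y : int) : R :=
  if y == x + 1 then w x else if y == x - 1 then 1 - w x else 0.

(* The Markov property is in product form, so that conditioning on
   histories of probability zero never arises. *)
Definition markov_chain (R : realType) (p : int -> int -> R) (x0 : int)
    (Q : probability traj_space R) :=
  Q [set X : trajectory | X 0%N = x0] = 1%E /\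
  forall (n : nat) (x : nat -> int),
    (Q [set X : trajectory | forall k, (k <= n.+1)%N -> X k = x k] =
     Q [set X : trajectory | forall k, (k <= n)%N -> X k = x k]
       * (p (x n) (x n.+1))%:E)%E.

Definition is_quenched_law (R : realType) (w : environment R)
    (Q : probability traj_space R) :=
  markov_chain (jump w) 0 Q.

(* Main.v *)
(* Write [V] for the potential of the environment and [W = exp V], so that
   [W x = rho_x W (x - 1)]; the scale function [H] with increments [W] is
   harmonic. On [0, L] the potential has ascents of height about
   [ln L / kappa], and no higher ones.
   Lower bound: the walk reaches a trap at distance [L], which costs
   [exp (- C L)] each way, and survives there for time [n] at rate
   [exp (- height)], i.e. with probability [exp (- n L^(-1/kappa))]; take
   [L = n^(kappa / (kappa + 1))].
   Upper bound: a function [G > 0] with [P_w G <= (1 - lambda) G] on [-L, L]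
   and [lambda] of order [L^(-b)], [b > 1 / kappa], bounds the walks that stay
   in [-L, L] for time [n] by [exp (- n lambda)], while coming back to [0] from
   [L], or reaching [-L], has probability [exp (- c L)].
   The bound on the ascents comes from [E (rho^s) < 1] for [0 < s < kappa], and
   the existence of high ascents from optional stopping for the martingale
   [(rho_1 ... rho_k)^kappa]. *)

Require Import Defs.
From HB Require Import structures.
From mathcomp Require Import all_boot all_order all_algebra finmap.
From mathcomp Require Import all_classical all_reals all_analysis.
From mathcomp Require Import measurable_realfun.
From mathcomp Require Import ring lra zify.

Set Implicit Arguments.
Unset Strict Implicit.
Unset Printing Implicit Defensive.

Import Order.TTheory GRing.Theory Num.Theory.
Import numFieldNormedType.Exports.

Local Open Scope classical_set_scope.
Local Open Scope ring_scope.

(** * The quenched law *)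

(** Apart from ellipticity, randomness enters only through two almost sure facts: a barrier profile
    for exponents b arbitrarily close to 1 / kappa from above, and, for every large K, an ascent of
    height tau^K within distance of order K^2 tau^(kappa K). All the rest concerns one fixed
    environment. There path decompositions are replaced by comparison: [return_prob] solves the
    backward equation, so supersolutions bound it above and subsolutions below, by induction on
    time. Infinity on the right is replaced by a site M > n, from which 0 cannot be reached in time
    n, so no limit of H is taken. A profile allows ascents to grow like |x|^b, which is where the
    rate L^(-b) comes from; balancing n L^(-b) against L gives the exponent 1 / (1 + b), which tends
    to kappa / (kappa + 1) as b decreases to 1 / kappa. The same profile makes W decay to the right
    of 0 and grow to the left, which controls both ends of [-L, L]. *)

Fixpoint return_prob (R : realType) (w : environment R) (n : nat) (x : int) : R :=
  if n is m.+1 then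
    w x * return_prob w m (x + 1) + (1 - w x) * return_prob w m (x - 1)
  else (x == 0)%:R.

Definition prefix_event (k : nat) (x : nat -> int) : set traj_space :=
  [set X : trajectory | forall j, (j <= k)%N -> X j = x j].

Lemma measurable_coord_event (n : nat) (z : int) :
  measurable ([set X : trajectory | X n = z] : set traj_space).
Proof.
apply: sub_sigma_algebra; exists n => //.
by exists [set z] => //; rewrite setTI.
Qed.

Lemma measurable_prefix_event k x : measurable (prefix_event k x).
Proof.
have -> : prefix_event k x =
    \bigcap_(j in `I_k.+1) [set X : trajectory | X j = x j].
  by apply/seteqP; split => X /= h j hj; apply: h; move: hj; rewrite /= ltnS.
apply: bigcap_measurable; first by exists 0%N.
by move=> j _; exact: measurable_coord_event.
Qed.

(** The chain is specified only by the masses of prefixes. When two disjoint continuations exhaust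
    the mass of a prefix, every other continuation is null, so any later event splits along these
    two. *)
Lemma measure_split_null d (T : measurableType d) (R : realType)
    (Q : probability T R) (A B C F : set T) :
  measurable A -> measurable B -> measurable C -> measurable F ->
  A `<=` C -> B `<=` C -> A `&` B = set0 -> Q C = (Q A + Q B)%E ->
  Q (C `&` F) = (Q (A `&` F) + Q (B `&` F))%E.
Proof.
move=> mA mB mC mF AC BC AB0 QC.
have mAB : measurable (A `|` B) by exact: measurableU.
have mCF := measurableI _ _ mC mF.
have null : Q (C `\` (A `|` B)) = 0%E.
  rewrite measureD//; last by rewrite ltey_eq fin_num_measure.
  rewrite setIUr (setIidr AC) (setIidr BC) measureU// -QC subee//.
  exact: fin_num_measure.
have -> : C `&` F = ((A `&` F) `|` (B `&` F)) `|` ((C `\` (A `|` B)) `&` F).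
  apply/seteqP; split => t /=; last by firstorder.
  by move=> [Ct Ft]; have [] := pselect ((A `|` B) t); firstorder.
have mAF := measurableI _ _ mA mF; have mBF := measurableI _ _ mB mF.
have mN : measurable ((C `\` (A `|` B)) `&` F).
  by apply: measurableI => //; exact: measurableD.
have nullF : Q ((C `\` (A `|` B)) `&` F) = 0%E.
  apply/eqP; rewrite eq_le measure_ge0 andbT -null.
  by apply: le_measure; rewrite ?inE //; exact: measurableD.
have e1 : Q ((A `&` F) `|` (B `&` F)) = (Q (A `&` F) + Q (B `&` F))%E.
  by apply: measureU => //; rewrite setIACA AB0 set0I.
rewrite -e1 -[RHS]adde0 -nullF; apply: measureU => //; first exact: measurableU.
by apply/seteqP; split => t //=; firstorder.
Qed.

(** Induction on the remaining time [m], for all prefixes at once: [ext z] appends the site [z], and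
    the jumps to the two neighbours carry the whole mass of the prefix. *)
Lemma quenched_prefix (R : realType) (w : environment R)
    (Q : probability traj_space R) : is_quenched_law w Q ->
  forall m k (x : nat -> int),
  Q (prefix_event k x `&` [set X : trajectory | X (k + m)%N = 0]) =
  (Q (prefix_event k x) * (return_prob w m (x k))%:E)%E.
Proof.
move=> [_ hQ]; elim=> [|m IH] k x.
  rewrite addn0 /=; have [xk0|xk0] := eqVneq (x k) 0.
    rewrite mule1; congr (Q _); apply/seteqP; split => X /=; first by case.
    by move=> h; split=> //; rewrite h.
  rewrite mule0 [X in Q X](_ : _ = set0) ?measure0//.
  apply/seteqP; split => X //= [h]; rewrite h// => /eqP.
  by rewrite (negbTE xk0).
pose ext z j : int := if j == k.+1 then z else x j.
have extE z : ext z k = x k by rewrite /ext ltn_eqF.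
have extS z : ext z k.+1 = z by rewrite /ext eqxx.
have pre z : prefix_event k (ext z) = prefix_event k x.
  by apply/seteqP; split => X /= h j jk; rewrite h// /ext ltn_eqF.
have sub z : prefix_event k.+1 (ext z) `<=` prefix_event k x.
  by rewrite -(pre z) => X /= h j jk; rewrite h// (leq_trans jk).
have step z : Q (prefix_event k.+1 (ext z)) =
    (Q (prefix_event k x) * (jump w (x k) z)%:E)%E.
  by rewrite [LHS]hQ extE extS -/(prefix_event k _) pre.
have jp : jump w (x k) (x k + 1) = w (x k) by rewrite /jump eqxx.
have jm : jump w (x k) (x k - 1) = 1 - w (x k).
  by rewrite /jump eqxx; case: ifP => // /eqP; lia.
have key := @measure_split_null _ _ _ Q (prefix_event k.+1 (ext (x k + 1)))
  (prefix_event k.+1 (ext (x k - 1))) (prefix_event k x)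
  [set X : trajectory | X (k + m.+1)%N = 0].
rewrite key; try exact: measurable_prefix_event; try exact: sub.
- rewrite addnS -addSn !IH !extS !step jp jm /=.
  rewrite -!muleA -!EFinM -muleDr; last exact: fin_num_adde_defr.
    by rewrite -EFinD.
  by rewrite fin_num_measure//; exact: measurable_prefix_event.
- exact: measurable_coord_event.
- apply/seteqP; split => X //= [h1 h2].
  by have := h1 k.+1 (leqnn _); rewrite h2// !extS => h; lia.
- rewrite !step jp jm -muleDr; last exact: fin_num_adde_defr.
    by rewrite -EFinD addrC subrK mule1.
  by rewrite fin_num_measure//; exact: measurable_prefix_event.
Qed.

Lemma quenched_return (R : realType) (w : environment R)
    (Q : probability traj_space R) (n : nat) : is_quenched_law w Q ->
  fine (Q [set X : trajectory | X n = 0]) = return_prob w n 0.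
Proof.
move=> hQ; have /= h := quenched_prefix hQ n 0%N (fun=> 0).
have Q0 : Q (prefix_event 0 (fun=> 0)) = 1%E.
  rewrite -(proj1 hQ); congr (Q _); apply/seteqP; split => X /=.
    by move=> ->.
  by move=> X0 [|j].
move: h; rewrite Q0 mul1e add0n => h.
suff -> : Q [set X : trajectory | X n = 0] = (return_prob w n 0)%:E by [].
rewrite -h -[X in Q X]setTI.
rewrite (@measure_split_null _ _ _ Q (prefix_event 0 (fun=> 0)) set0)//.
- by rewrite set0I measure0 adde0.
- exact: measurable_prefix_event.
- exact: measurable_coord_event.
- by rewrite setI0.
- by rewrite measure0 adde0 Q0; exact: probability_setT.
Qed.

(** * Harmonic functions of a fixed environment *)

Lemma int_primitive (R : zmodType) (f : int -> R) :
  exists2 H : int -> R, H 0 = 0 & forall x, H (x + 1) = H x + f x.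
Proof.
exists (fun x => match x with
  | Posz n => \sum_(i < n) f i%:Z
  | Negz n => - \sum_(i < n.+1) f (Negz i) end).
  by rewrite [LHS]big_ord0.
case=> [n|[|n]].
- have -> : n%:Z + 1 = n.+1%:Z by lia.
  by rewrite big_ord_recr.
- have -> : Negz 0 + 1 = 0%N%:Z by lia.
  by rewrite big_ord0 big_ord_recr big_ord0/= add0r addNr.
- have -> : Negz n.+1 + 1 = Negz n by lia.
  by rewrite [in RHS]big_ord_recr /= opprD subrK.
Qed.

Lemma int_geometric_primitive (R : realFieldType) (f : int -> R) :
  (forall x, 0 < f x) ->
  exists G : int -> R, [/\ G 0 = 1, forall x, 0 < G x &
    forall x, G (x + 1) = f x * G x].
Proof.
move=> f0.
exists (fun x => match x with
  | Posz n => \prod_(i < n) f i%:Z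
  | Negz n => (\prod_(i < n.+1) f (Negz i))^-1 end); split.
- by rewrite [LHS]big_ord0.
- by case=> n; rewrite ?invr_gt0; apply: prodr_gt0.
- case=> [n|[|n]].
  + have -> : n%:Z + 1 = n.+1%:Z by lia.
    by rewrite big_ord_recr/= mulrC.
  + have -> : Negz 0 + 1 = 0%N%:Z by lia.
    by rewrite big_ord0 big_ord_recr big_ord0/= mul1r mulfV// gt_eqF.
  + have -> : Negz n.+1 + 1 = Negz n by lia.
    rewrite [in RHS]big_ord_recr /= invfM mulrC -mulrA mulVf ?mulr1//.
    by rewrite gt_eqF.
Qed.

Section quenched_bounds.
Context (R : realType) (w : environment R).

Let w0 x : 0 < w x. Proof. by have /andP[] := omega_in01 w x. Qed.
Let w1 x : 0 < 1 - w x.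
Proof. by rewrite subr_gt0; have /andP[] := omega_in01 w x. Qed.

Lemma rho_gt0 x : 0 < rho w x. Proof. by rewrite divr_gt0. Qed.

Lemma return_prob_ge0 n x : 0 <= return_prob w n x.
Proof.
elim: n x => [|n IH] x /=; first by case: (x == 0).
by rewrite addr_ge0// mulr_ge0// ltW.
Qed.

Lemma return_prob_le1 n x : return_prob w n x <= 1.
Proof.
elim: n x => [|n IH] x /=; first by case: (x == 0).
rewrite -[leRHS](subrKC (w x)) lerD//.
  by rewrite ler_piMr// ltW.
by rewrite ler_piMr// ltW.
Qed.

Lemma return_prob_far n x : n%:Z < x -> return_prob w n x = 0.
Proof.
elim: n x => [|n IH] x nx /=; first by rewrite gt_eqF.
by rewrite !IH ?mulr0 ?addr0//; lia.
Qed.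

(* W is the edge weight [exp V] of the potential, H the scale function. *)
Variables (W H : int -> R).
Hypothesis W0 : W 0 = 1.
Hypothesis W_gt0 : forall x, 0 < W x.
Hypothesis WS : forall x, W (x + 1) = rho w (x + 1) * W x.
Hypothesis HS : forall x, H (x + 1) = H x + W x.

Lemma scale_harmonic x : w x * H (x + 1) + (1 - w x) * H (x - 1) = H x.
Proof.
have e : x - 1 + 1 = x by lia.
rewrite HS; have := HS (x - 1); have := WS (x - 1); rewrite !e => -> ->.
by rewrite /rho; have := w0 x => ?; field; rewrite gt_eqF.
Qed.

Lemma scale_le x y : x <= y -> H x <= H y.
Proof.
move=> xy; have -> : y = x + `|y - x|%N%:Z by lia.
elim: `|y - x|%N => [|n IH]; first by rewrite addr0.
have -> : x + n.+1%:Z = x + n%:Z + 1 by lia.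
by rewrite HS; apply: le_trans IH _; rewrite lerDl ltW.
Qed.

Lemma scale_diff_ge x y : x < y -> W x <= H y - H x.
Proof.
move=> xy; have := @scale_le (x + 1) y; rewrite HS => h.
by have := h (ltac:(lia)); lra.
Qed.

(** [H M - H x] is harmonic and, since [W 0 = 1], at least 1 at 0; at [M] the return probability
    vanishes because time [n] is too short to come back. *)
Lemma return_prob_le_scale (M n : nat) x : (n < M)%N -> 0 <= x <= M%:Z ->
  return_prob w n x <= H M - H x.
Proof.
elim: n x => [|n IH] x nM xM.
  rewrite /=; case: eqVneq => [->|_]; last by rewrite subr_ge0 scale_le; lia.
  by have := @scale_diff_ge 0 M ltac:(lia); rewrite W0.
have [x0|x0] := eqVneq x 0.
  rewrite x0; apply: le_trans (return_prob_le1 _ _) _.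
  by have := @scale_diff_ge 0 M ltac:(lia); rewrite W0.
have [xM'|xM'] := eqVneq x M.
  by rewrite xM' subrr return_prob_far//; lia.
rewrite /= -{1}(scale_harmonic x).
have -> : H M - (w x * H (x + 1) + (1 - w x) * H (x - 1)) =
  w x * (H M - H (x + 1)) + (1 - w x) * (H M - H (x - 1)) by ring.
rewrite lerD// ler_pM2l//; apply: IH; lia.
Qed.

(* The three terms account for the walks that stay in [-L, L], those that
   reach -L, and those that come back to 0 from L. *)
Lemma return_prob_le_lyapunov (lam : R) (G : int -> R) (L M n : nat) :
  0 <= lam <= 1 -> G 0 = 1 -> (forall x, 0 < G x) ->
  (forall x : int, `|x| < L%:Z ->
     w x * G (x + 1) + (1 - w x) * G (x - 1) <= (1 - lam) * G x) ->
  (0 < L)%N -> (L <= M)%N -> (n < M)%N ->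
  return_prob w n 0 <= (1 - lam) ^+ n
    + (H M - H 0) / (H M - H (- L%:Z)) + (H M - H L).
Proof.
move=> lam01 G0 G_gt0 GL L0 LM.
suff gen (x : int) : (n < M)%N -> `|x| <= L%:Z -> return_prob w n x <=
    (1 - lam) ^+ n * G x + (H M - H x) / (H M - H (- L%:Z)) + (H M - H L).
  by move=> nM; have := gen 0 nM; rewrite G0 mulr1; apply.
have D0 : 0 < H M - H (- L%:Z).
  by apply: lt_le_trans (@scale_diff_ge _ _ _) => //; lia.
have lam0 k : 0 <= (1 - lam) ^+ k.
  by apply: exprn_ge0; case/andP: lam01; rewrite subr_ge0.
have e0 : 0 <= H M - H L by rewrite subr_ge0 scale_le.
have a0 (y : int) : `|y| <= L%:Z -> 0 <= (H M - H y) / (H M - H (- L%:Z)).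
  by move=> yL; rewrite divr_ge0 ?subr_ge0 ?scale_le//; lia.
elim: n x => [|n IH] x nM xL.
  rewrite expr0 mul1r /=; case: eqVneq => [->|_].
    by rewrite G0 /=; have := a0 0 ltac:(lia); lra.
  by have := a0 x xL; have := G_gt0 x; rewrite /=; lra.
have [xL'|xL'] := eqVneq x (- L%:Z).
  rewrite xL' mulfV ?gt_eqF//; apply: le_trans (return_prob_le1 _ _) _.
  by have := mulr_ge0 (lam0 n.+1) (ltW (G_gt0 (- L%:Z))); lra.
have [xL''|xL''] := eqVneq x L%:Z.
  rewrite xL''; apply: le_trans (return_prob_le_scale nM _) _; first by lia.
  have := mulr_ge0 (lam0 n.+1) (ltW (G_gt0 L)).
  by have := a0 L%:Z ltac:(lia); lra.
have IH1 := IH (x + 1) ltac:(lia) ltac:(lia).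
have IH2 := IH (x - 1) ltac:(lia) ltac:(lia).
have GL' := ler_wpM2l (lam0 n) (GL x ltac:(lia)).
rewrite /=.
apply: le_trans (lerD (ler_wpM2l (ltW (w0 x)) IH1) (ler_wpM2l (ltW (w1 x)) IH2)) _.
set D := (H M - H (- _)); set c := (1 - lam) ^+ n.
have -> : w x * (c * G (x + 1) + (H M - H (x + 1)) / D + (H M - H L)) +
    (1 - w x) * (c * G (x - 1) + (H M - H (x - 1)) / D + (H M - H L)) =
    c * (w x * G (x + 1) + (1 - w x) * G (x - 1)) +
    (H M - (w x * H (x + 1) + (1 - w x) * H (x - 1))) / D + (H M - H L).
  by ring.
by rewrite scale_harmonic !lerD2r exprS -mulrA mulrCA.
Qed.



(** The tent [g] is affine in [H] on each side of its peak [x], so harmonicity fails only at [a] and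
    [b], where [g] vanishes, and at [x], where the defect is the probability of escaping to [a] or
    [b] before returning to [x]. *)
Lemma trap_subharmonic (g : int -> R) (a x b : int) (y : int) :
  a < x < b ->
  (forall z, g z = if z <= a then 0 else if z <= x then
     (H z - H a) / (H x - H a) else
     if z < b then (H b - H z) / (H b - H x) else 0) ->
  (1 - (W x / (H b - H x) + W x / (H x - H a))) * g y <=
  w y * g (y + 1) + (1 - w y) * g (y - 1).
Proof.
move=> /andP[ax xb] gE; set d := _ / _ + _ / _.
have Da : 0 < H x - H a by apply: lt_le_trans (@scale_diff_ge _ _ _) => //.
have Db : 0 < H b - H x by apply: lt_le_trans (@scale_diff_ge _ _ _) => //.
have d0 : 0 <= d by rewrite addr_ge0// divr_ge0// ltW.
have g0 z : 0 <= g z.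
  rewrite gE; case: ifPn => // za; case: ifPn => zx.
    by rewrite divr_ge0 ?(ltW Da)// subr_ge0 scale_le//; lia.
  by case: ifPn => // zb; rewrite divr_ge0 ?(ltW Db)// subr_ge0 scale_le//; lia.
have Pg0 z : 0 <= w z * g (z + 1) + (1 - w z) * g (z - 1).
  by rewrite addr_ge0// mulr_ge0// ltW.
have gl z : a <= z <= x -> g z = (H z - H a) / (H x - H a).
  move=> zax; rewrite gE; case: ifPn => za; last by rewrite ifT//; lia.
  by have -> : z = a by [lia]; rewrite subrr mul0r.
have gr z : x <= z <= b -> g z = (H b - H z) / (H b - H x).
  move=> zax; rewrite gE ifF; last by lia.
  case: ifPn => za.
    by have -> : z = x by [lia]; rewrite !mulfV// gt_eqF.
  case: ifPn => // zb.
  by have -> : z = b by [lia]; rewrite subrr mul0r.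
have dg z : (1 - d) * g z <= g z by rewrite ler_piMl// lerBlDr lerDl.
have [ya|ya] := leP y a.
  by rewrite gE ya mulr0.
have [yb|yb] := leP b y.
  by rewrite gE; do !(rewrite ifF; last by lia); rewrite mulr0.
have hy := scale_harmonic y.
have [yx|yx|yx] := ltgtP y x.
- rewrite (gl (y + 1)) ?(gl (y - 1)); try lia.
  apply: le_trans (dg y) _; rewrite (gl y); last by lia.
  rewrite -[in leLHS]hy le_eqVlt; apply/orP; left; apply/eqP; ring.
- rewrite (gr (y + 1)) ?(gr (y - 1)); try lia.
  apply: le_trans (dg y) _; rewrite (gr y); last by lia.
  rewrite -[in leLHS]hy le_eqVlt; apply/orP; left; apply/eqP; ring.
- rewrite yx (gr (x + 1)) ?(gl (x - 1)) ?(gl x) ?mulfV ?gt_eqF//; try lia.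
  (* Harmonicity gives the steps to both sides of [x] the same weight [w x * W x], so the defect is
     [w x] times the stated rate. *)
  have Hm : (1 - w x) * H (x - 1) = H x - w x * H (x + 1).
    by rewrite -(scale_harmonic x); ring.
  rewrite mulr1.
  have -> : w x * ((H b - H (x + 1)) / (H b - H x)) +
    (1 - w x) * ((H (x - 1) - H a) / (H x - H a)) =
    1 - (w x * (H (x + 1) - H x) / (H b - H x) + ((1 - w x) * H x - (1 - w x) * H (x - 1)) / (H x - H a)).
    by field; rewrite !gt_eqF.
  rewrite Hm HS lerD2l lerN2 /d.
  have -> : (1 - w x) * H x - (H x - w x * (H x + W x)) = w x * W x by ring.
  have -> : H x + W x - H x = W x by ring.
  have wW : w x * W x <= W x.
    by rewrite ler_piMl ?ltW//; have /andP[] := omega_in01 w x.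
  by rewrite lerD// ler_pM2r ?invr_gt0.
Qed.

Lemma return_prob_step_ge (c : R) n x : 0 <= c -> (forall y, c <= w y <= 1 - c) ->
  forall s : bool, c * return_prob w n (if s then x + 1 else x - 1) <= return_prob w n.+1 x.
Proof.
move=> c0 cw s /=; have /andP[cw1 cw2] := cw x.
have u0 := return_prob_ge0.
case: s; [apply: ler_wpDr|apply: ler_wpDl].
- by rewrite mulr_ge0// ltW.
- by rewrite ler_wpM2r.
- by rewrite mulr_ge0// ltW.
- by rewrite ler_wpM2r//; lra.
Qed.

Lemma return_prob_reach (c : R) : 0 <= c -> (forall y, c <= w y <= 1 - c) ->
  forall n (x : int) , `|x| <= n%:Z -> ~~ odd (n + `|x|)%N ->
  c ^+ n <= return_prob w n x.
Proof.
move=> c0 cw; elim=> [|n IH] x xn odd_nx.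
  by have -> : x = 0 by [lia]; rewrite expr0.
(* The step goes towards 0, and from 0 to 1: spare time is spent oscillating, and parity brings the
   walk back in time. *)
pose s := (x <= 0) : bool.
apply: le_trans (return_prob_step_ge n x c0 cw s).
by rewrite exprS ler_wpM2l// /s; case: ifPn => x0; apply: IH; lia.
Qed.

Lemma return_prob_walk (c : R) : 0 <= c -> (forall y, c <= w y <= 1 - c) ->
  forall (k n : nat), c ^+ k * return_prob w n k%:Z <= return_prob w (k + n) 0.
Proof.
move=> c0 cw k n.
suff gen j i : c ^+ j * return_prob w n (i + j)%N%:Z <=
    return_prob w (j + n) i%:Z by have := gen k 0%N; rewrite add0n.
elim: j i => [|j IH] i; first by rewrite addn0 expr0 mul1r.
apply: le_trans (return_prob_step_ge (j + n) i c0 cw true).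
rewrite exprS -mulrA ler_wpM2l//.
have -> : i%:Z + 1 = i.+1%:Z by lia.
by apply: le_trans (IH i.+1); rewrite addSnnS.
Qed.

(** The time splits into [x] forced steps from 0 to the peak, a stay during which the subsolution
    [g] loses a factor [1 - d] per step, and [L] steps back to 0 from wherever the walk is in
    [[-L, L]]. The even total time settles the parity in [main]. *)
Lemma return_prob_ge_trap (c : R) (g : int -> R) (d : R) (L x n : nat) :
  0 <= c -> (forall y, c <= w y <= 1 - c) -> d <= 1 ->
  (forall y, 0 <= g y <= 1) -> (forall y : int, L%:Z < `|y| -> g y = 0) ->
  (forall y, (1 - d) * g y <= w y * g (y + 1) + (1 - w y) * g (y - 1)) ->
  g x = 1 -> (x <= L)%N -> (x + L <= 2 * n)%N ->
  c ^+ (x + L) * (1 - d) ^+ (2 * n - (x + L)) <= return_prob w (2 * n) 0.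
Proof.
move=> c0 cw d1 g01 gL gP gx xL nL.
have main m (y : int) : ~~ odd (L + m + `|y|)%N ->
    c ^+ L * (1 - d) ^+ m * g y <= return_prob w (L + m) y.
  elim: m y => [|m IH] y.
    rewrite addn0 expr0 mulr1 => odd_y.
    have [yL|yL] := leP `|y| L%:Z; last first.
      by rewrite gL ?mulr0 ?return_prob_ge0//; lia.
    apply: le_trans (return_prob_reach c0 cw yL odd_y).
    by rewrite ler_piMr ?exprn_ge0//; case/andP: (g01 y).
  move=> odd_y; rewrite addnS /=.
  have IH1 := IH (y + 1) ltac:(lia); have IH2 := IH (y - 1) ltac:(lia).
  apply: le_trans (lerD (ler_wpM2l (ltW (w0 y)) IH1) (ler_wpM2l (ltW (w1 y)) IH2)).
  rewrite -mulrA [leRHS](_ : _ = c ^+ L * ((1 - d) ^+ m *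
     (w y * g (y + 1) + (1 - w y) * g (y - 1)))); last by ring.
  rewrite ler_wpM2l ?exprn_ge0// exprS [(1 - d) * _]mulrC -mulrA.
  by rewrite ler_wpM2l ?exprn_ge0// subr_ge0.
have [m em] : exists m, (2 * n = x + (L + m))%N.
  by exists (2 * n - (x + L))%N; lia.
have -> : (2 * n - (x + L) = m)%N by lia.
rewrite em; apply: le_trans (return_prob_walk c0 cw x _).
rewrite exprD -mulrA ler_wpM2l ?exprn_ge0//.
by have := main m x%:Z; rewrite gx mulr1; apply; lia.
Qed.

Lemma return_prob_trap (c d : R) (L x z n : nat) :
  0 < c -> (forall y, c <= w y <= 1 - c) ->
  (x <= z)%N -> (z < L)%N -> W x / W z + W x / W (- L%:Z) <= d -> d <= 1 ->
  (L <= n)%N ->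
  c ^+ (2 * L) * (1 - d) ^+ (2 * n) <= return_prob w (2 * n) 0.
Proof.
move=> c0 cw xz zL dW d1 Ln.
have /andP[c1 c2] := cw 0.
have cle1 : c <= 1 by have := w1 0; lra.
(* The right wall is the top [z] of an ascent from [x], the left wall the far site [-L]. A single
   weight at each wall, [W z] and [W (- L)], bounds the scale difference from below. *)
pose a : int := - L%:Z; pose b : int := z.+1%:Z.
pose g (y : int) := if y <= a then 0 else if y <= x%:Z then
     (H y - H a) / (H x - H a) else
     if y < b then (H b - H y) / (H b - H x) else 0.
pose e := W x / (H b - H x) + W x / (H x - H a).
have axb : a < x%:Z < b by rewrite /a /b; lia.
have Da : 0 < H x - H a.
  by apply: lt_le_trans (@scale_diff_ge _ _ _) => //; case/andP: axb.
have Db : 0 < H b - H x.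
  by apply: lt_le_trans (@scale_diff_ge _ _ _) => //; case/andP: axb.
have ed : e <= d.
  apply: le_trans dW; apply: lerD; rewrite ler_pM2l// lef_pV2 ?posrE//.
    have -> : H b = H z + W z by rewrite -HS; congr H; rewrite /b; lia.
    have : H x <= H z by apply: scale_le; lia.
    by lra.
  by apply: scale_diff_ge; case/andP: axb.
have g01 y : 0 <= g y <= 1.
  rewrite /g; case: ifPn => [_|ya]; first by rewrite lexx ler01.
  case: ifPn => yx.
    rewrite divr_ge0 ?(ltW Da) ?subr_ge0 ?scale_le ?ler_pdivrMr ?mul1r//; last by lia.
    by rewrite lerB// scale_le.
  case: ifPn => yb; last by rewrite lexx ler01.
  rewrite divr_ge0 ?(ltW Db) ?subr_ge0 ?scale_le ?ler_pdivrMr ?mul1r//; last by lia.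
  by rewrite lerB// scale_le//; lia.
have gx : g x = 1.
  rewrite /g ifF; last by rewrite /a; lia.
  by rewrite lexx mulfV// gt_eqF.
have /= := @return_prob_ge_trap c g e L x n (ltW c0) cw (le_trans ed d1) g01.
move=> /(_ _ _ gx); rewrite /a => h; apply: le_trans (h _ _ _ _).
- apply: ler_pM; rewrite ?exprn_ge0 ?(ltW c0) ?subr_ge0//.
    by apply: ler_wiXn2l => //; [exact: ltW|clear -xz zL; lia].
  apply: le_trans (_ : (1 - d) ^+ (2 * n - (x + L)) <= _).
    apply: ler_wiXn2l; rewrite ?subr_ge0 ?leq_subr//.
    rewrite lerBlDr lerDl; apply: le_trans dW.
    by rewrite addr_ge0// divr_ge0// ltW.
  by rewrite lerXn2r ?nnegrE ?subr_ge0 ?lerB//; exact: le_trans ed d1.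
- move=> y yL; rewrite /g; case: ifPn => // ya; rewrite ifF.
    by rewrite ifF// /b; clear -xz zL yL ya; lia.
  by clear -xz zL yL ya; lia.
- by move=> y; exact: (trap_subharmonic y axb).
- by clear -xz zL; lia.
- by clear -xz zL Ln; lia.
Qed.

(* G(x) / G(x + 1) = 1 + mu * m x plays the role of the exponential moment of
   the crossing time from x to x + 1. *)
Lemma lyapunov_ex (c r mu : R) (m : int -> R) (L : nat) :
  0 < c -> (forall x, c <= w x) -> 0 < mu -> r < 1 ->
  (forall x, 1 <= m x) -> (forall x, rho w x * m (x - 1) <= r * m x) ->
  (forall x : int, `|x| < L%:Z -> mu * m x <= (1 - r) / 2) ->
  exists G : int -> R, [/\ G 0 = 1, forall x, 0 < G x &
    forall x : int, `|x| < L%:Z ->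
      w x * G (x + 1) + (1 - w x) * G (x - 1) <=
      (1 - c * mu * (1 - r) / 2) * G x].
Proof.
move=> c0 cw mu0 r1 m1 mr mL.
have m0 x : 0 < m x by apply: lt_le_trans (m1 x).
have e0 x : 0 < mu * m x by rewrite mulr_gt0.
have f0 x : 0 < (1 + mu * m x)^-1 by rewrite invr_gt0 addr_gt0.
have [G [G0 G_gt0 GS]] := int_geometric_primitive f0.
exists G; split=> // x xL.
have -> : G (x - 1) = (1 + mu * m (x - 1)) * G x.
  have := GS (x - 1); have -> : x - 1 + 1 = x by lia.
  by move=> ->; rewrite mulrA mulfV ?mul1r// gt_eqF// addr_gt0.
rewrite GS !mulrA -mulrDl ler_pM2r//.
have h1 : (1 - w x) * (mu * m (x - 1)) <= w x * (r * (mu * m x)).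
  have -> : (1 - w x) * (mu * m (x - 1)) = w x * (mu * (rho w x * m (x - 1))).
    by rewrite /rho; field; rewrite gt_eqF.
  by rewrite ler_pM2l// [leRHS]mulrCA ler_pM2l.
have e1 := mL x xL; have em : mu <= mu * m x by rewrite ler_peMr// ltW.
move: h1 e1 em (e0 x); set e := mu * m x; set f := mu * m (x - 1) => h1 e1 em ex0.
(* With [h1] this bounds the ratio by [1 - w x * (e * (1 - e - r))]. The bound [e <= (1 - r) / 2]
   keeps half of the gap [1 - r]; then [mu <= e] and [c <= w x] give the stated rate. *)
have h2 : (1 + e)^-1 <= 1 - e + e * e.
  rewrite -div1r ler_pdivrMr ?addr_gt0//.
  have -> : (1 - e + e * e) * (1 + e) = 1 + e * e * e by ring.
  by rewrite lerDl !mulr_ge0// ltW.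
have h3 := ler_wpM2l (ltW (w0 x)) h2.
have h4 : e * (1 - r) / 2 <= e * (1 - e - r).
  by rewrite -mulrA ler_pM2l//; lra.
have h5 := ler_wpM2l (ltW (w0 x)) h4.
have h6 : c * mu * (1 - r) / 2 <= w x * (e * (1 - r) / 2).
  have : 0 <= (1 - r) / 2 by lra.
  move=> hr; rewrite -!mulrA; apply: ler_pM; rewrite ?(ltW c0)//.
    by rewrite mulr_ge0// ltW.
  by rewrite ler_pM2l// ler_peMl.
rewrite mulrDr mulr1; lra.
Qed.

Lemma scale_tail (B q : R) : 0 <= B -> 0 < q < 1 ->
  (forall y : nat, W y <= B * q ^+ y) ->
  forall L j : nat, H (L + j)%N - H L <= B / (1 - q) * q ^+ L.
Proof.
move=> B0 /andP[q0 q1] WB L j.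
have B0' : 0 <= B / (1 - q) by rewrite divr_ge0// subr_ge0 ltW.
suff : H (L + j)%N - H L <= B / (1 - q) * (q ^+ L - q ^+ (L + j)).
  by move/le_trans; apply; rewrite ler_wpM2l// lerBlDr lerDl exprn_ge0// ltW.
elim: j => [|j IH]; first by rewrite addn0 !subrr mulr0.
have -> : (L + j.+1)%N%:Z = (L + j)%N%:Z + 1 by lia.
rewrite HS; have := WB (L + j)%N => h.
have -> : B / (1 - q) * (q ^+ L - q ^+ (L + j.+1)) =
  B / (1 - q) * (q ^+ L - q ^+ (L + j)) + B * q ^+ (L + j).
  by rewrite addnS exprS; field; rewrite gt_eqF// subr_gt0.
by lra.
Qed.

(** Iterates the profile inequality over [k] sites. With [x = k] it shows that [W] decays to the
    right of 0, with [x = 0] that it grows to the left. *)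
Lemma weight_decay (r : R) (m : int -> R) :
  (forall x, rho w x * m (x - 1) <= r * m x) -> 0 <= r ->
  forall (x : int) (k : nat), W x * m (x - k%:Z) <= r ^+ k * m x * W (x - k%:Z).
Proof.
move=> mr r0 x; elim=> [|k IH]; first by rewrite subr0 expr0 mul1r mulrC.
have e : x - k%:Z = x - k.+1%:Z + 1 by lia.
have rm : rho w (x - k%:Z) * m (x - k.+1%:Z) <= r * m (x - k%:Z).
  by have := mr (x - k%:Z); have -> : x - k%:Z - 1 = x - k.+1%:Z by lia.
move: IH; rewrite {2}e WS -e => IH.
have rk : 0 < rho w (x - k%:Z) by exact: rho_gt0.
rewrite -(ler_pM2l rk) mulrCA; apply: le_trans (ler_wpM2l (ltW (W_gt0 x)) rm) _.
rewrite mulrCA; apply: le_trans (ler_wpM2l r0 IH) _.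
by rewrite exprS le_eqVlt; apply/orP; left; apply/eqP; ring.
Qed.


End quenched_bounds.

(** * Quenched bounds from a barrier profile *)

Lemma powR_geometric_bounded (R : realType) (b q : R) : 0 < b -> 0 < q < 1 ->
  exists2 B : R, 0 < B & forall n : nat, n.+1%:R `^ b * q ^+ n <= B.
Proof.
move=> b0 /andP[q0 q1].
have lq : ln q < 0 by rewrite ln_lt0// q0.
(* Chosen so that [b * e = - ln q]; the bound is then [ln t <= t - 1] at [t = e * n.+1], and the
   constant is the maximum over real [n]. *)
pose e := - ln q / b; have e0 : 0 < e by rewrite divr_gt0// oppr_gt0.
exists (expR (b * (e - 1 - ln e))); first exact: expR_gt0.
move=> n; have n0 : 0 < n.+1%:R :> R by rewrite ltr0n.
rewrite -(lnK (x := q)) ?posrE// -expRM_natl -(lnK (x := n.+1%:R `^ b)); last first.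
  by rewrite posrE powR_gt0.
rewrite ln_powR -expRD ler_expR.
have : ln (e * n.+1%:R) <= e * n.+1%:R - 1.
  have := @ln_sublinear R (e * n.+1%:R) (mulr_gt0 e0 n0).
  have := @le_ln1Dx R (e * n.+1%:R - 1); have := mulr_gt0 e0 n0.
  have -> : 1 + (e * n.+1%:R - 1) = e * n.+1%:R by ring.
  by move=> h1 h2 _; apply: h2; lra.
rewrite lnM ?posrE// => h.
have hb := ler_wpM2l (ltW b0) h.
have be : b * e = - ln q by rewrite /e mulrC divfK// gt_eqF.
have -> : ln q = - (b * e) by rewrite be opprK.
move: hb; rewrite -natr1 => hb.
lra.
Qed.

(* A profile controlling the heights of all barriers: iterating the recursive
   inequality bounds rho_x ... rho_{x-k+1} by r^k C (|x| + 1)^b. *)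
Definition barrier_profile (R : realType) (w : environment R) (b r C : R)
    (m : int -> R) :=
  [/\ 0 < r < 1, forall x, 1 <= m x, forall x, m x <= C * (`|x|%N.+1)%:R `^ b &
      forall x, rho w x * m (x - 1) <= r * m x].

Lemma return_prob_upper (R : realType) (w : environment R) (c b r C : R) m :
  0 < c -> (forall y, c <= w y <= 1 - c) -> 0 < b ->
  barrier_profile w b r C m ->
  exists a B q : R, [/\ 0 < a, 0 < B, 0 < q < 1 & forall n L : nat, (0 < L)%N ->
    return_prob w n 0 <= expR (- (a * n%:R * L.+1%:R `^ (- b))) + B * q ^+ L].
Proof.
move=> c0 cw b0 [/andP[r0 r1] m1 mC mr].
have C0 : 0 < C.
  have := le_trans (m1 0) (mC 0); rewrite absz0 powR1 mulr1.
  by apply: lt_le_trans.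
have [W [W0 W_gt0 WS0]] := int_geometric_primitive (fun x => rho_gt0 w (x + 1)).
have WS : forall x, W (x + 1) = rho w (x + 1) * W x by [].
have [H H0 HS] := int_primitive W.
(* A ratio strictly between [r] and 1: the spare factor [(r / q) ^+ y] absorbs the polynomial growth
   of the profile. *)
pose q := (r + 1) / 2.
have rq : r < q by rewrite /q; lra.
have q0 : 0 < q by rewrite /q; lra.
have q1 : q < 1 by rewrite /q; lra.
have rq01 : 0 < r / q < 1 by rewrite divr_gt0// ltr_pdivrMr// mul1r rq.
have [B1 B1_gt0 hB1] := powR_geometric_bounded b0 rq01.
pose B := C * B1; have B0 : 0 < B by rewrite mulr_gt0.
have WB (y : nat) : W y <= B * q ^+ y.
  have := weight_decay W_gt0 WS mr (ltW r0) y y; rewrite subrr W0 mulr1 => h.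
  have : W y * 1 <= r ^+ y * m y.
    by apply: le_trans h; rewrite ler_pM2l.
  rewrite mulr1 => /le_trans; apply.
  apply: le_trans (ler_wpM2l (exprn_ge0 _ (ltW r0)) (mC y)) _.
  have := ler_wpM2r (exprn_ge0 y (ltW q0)) (hB1 y).
  rewrite expr_div_n mulrA divfK ?expf_neq0 ?gt_eqF// => h2.
  have := ler_wpM2l (ltW C0) h2; rewrite /B absz_nat.
  by rewrite -mulrA [r ^+ y * (_ * _)]mulrCA [r ^+ y * _]mulrC.
have WL (L : nat) : (W (- L%:Z))^-1 <= C * q ^+ L.
  have := weight_decay W_gt0 WS mr (ltW r0) 0 L; rewrite W0 mul1r sub0r => h.
  have m0 : m 0 <= C by have := mC 0; rewrite absz0 powR1 mulr1.
  have : 1 <= r ^+ L * C * W (- L%:Z).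
    apply: le_trans (m1 _) (le_trans h _).
    by rewrite ler_pM2r// ler_pM2l// exprn_gt0.
  rewrite -ler_pdivrMr// div1r => /le_trans; apply.
  by rewrite mulrC ler_pM2l// lerXn2r ?nnegrE ?ltW.
pose K := B / (1 - q); have K0 : 0 < K by rewrite divr_gt0// subr_gt0.
(* As large as the growth bound on [m] allows while keeping [mu L * m x <= (1 - r) / 2] on the whole
   of [(-L, L)]. *)
pose mu L : R := (1 - r) / 2 / C * L.+1%:R `^ (- b).
exists (c * ((1 - r) / 2 / C) * (1 - r) / 2), (K * C + K), q; split.
- by rewrite !(mulr_gt0, divr_gt0, invr_gt0)// subr_gt0.
- by rewrite addr_gt0// mulr_gt0.
- by rewrite q0.
move=> n L L0.
have LL0 : 0 < L.+1%:R `^ (- b) :> R by rewrite powR_gt0// ltr0n.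
have mu0 : 0 < mu L by rewrite /mu !(mulr_gt0, divr_gt0, invr_gt0)// subr_gt0.
have mL (x : int) : `|x| < L%:Z -> mu L * m x <= (1 - r) / 2.
  move=> xL; apply: le_trans (ler_wpM2l (ltW mu0) (mC x)) _.
  have -> : mu L * (C * (`|x|.+1)%:R `^ b) =
    (1 - r) / 2 * (L.+1%:R `^ (- b) * (`|x|.+1)%:R `^ b).
    by rewrite /mu; field; rewrite gt_eqF.
  rewrite ler_piMr//; first by rewrite divr_ge0// subr_ge0 ltW.
  rewrite powRN mulrC ler_pdivrMr ?powR_gt0 ?ltr0n// mul1r.
  apply: ge0_ler_powR; rewrite ?nnegrE ?ler0n ?(ltW b0)// ler_nat.
  by move: xL; clear; lia.
have cw' y : c <= w y by case/andP: (cw y).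
have [G [G0 G_gt0 GL]] := lyapunov_ex c0 cw' mu0 r1 m1 mr mL.
pose lam := c * mu L * (1 - r) / 2.
have lam0 : 0 < lam.
  by apply: divr_gt0 => //; apply: mulr_gt0; [exact: mulr_gt0|rewrite subr_gt0].
have lam1 : lam <= 1.
  have := GL 0; rewrite normr0 => /(_ L0).
  have : 0 < w 0 * G (0 + 1) + (1 - w 0) * G (0 - 1).
    have /andP[h1 h2] := omega_in01 w 0.
    by rewrite addr_gt0// mulr_gt0// subr_gt0.
  move=> h1 /(lt_le_trans h1); rewrite -/lam pmulr_lgt0// subr_gt0.
  exact: ltW.
have lam01 : 0 <= lam <= 1 by rewrite ltW.
(* The right end [L + n.+1] is one site beyond both [L] and the reach of [n] steps; the tail bounds
   on [H] are uniform in it. *)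
have := @return_prob_le_lyapunov _ w W H W0 W_gt0 WS HS lam G L (L + n.+1) n.
move=> /(_ lam01 G0 G_gt0 GL L0 (leq_addr _ _)); rewrite ltn_addl// => /(_ isT).
move=> /le_trans; apply; rewrite -addrA; apply: lerD.
  apply: le_trans (_ : expR (- lam) ^+ n <= _).
    rewrite lerXn2r ?nnegrE ?subr_ge0// ?expR_ge0//.
    by have := expR_ge1Dx (- lam).
  rewrite -expRM_natl ler_expR -mulr_natl le_eqVlt; apply/orP; left.
  by apply/eqP; rewrite /lam /mu; ring.
have tail := scale_tail HS (ltW B0).
have q01 : 0 < q < 1 by rewrite q0.
have t1 := tail q q01 WB L n.+1; have t2 := tail q q01 WB 0%N (L + n.+1)%N.
rewrite [leRHS]mulrDl; apply: lerD => //.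
have D0 : W (- L%:Z) <= H (L + n.+1)%N - H (- L%:Z).
  by apply: (scale_diff_ge W_gt0 HS); clear; lia.
apply: le_trans (_ : K * (C * q ^+ L) <= _); last by rewrite mulrA.
apply: ler_pM.
- by rewrite subr_ge0; apply: (scale_le W_gt0 HS).
- by rewrite invr_ge0; apply: le_trans D0; exact: ltW.
- by move: t2; rewrite add0n expr0 mulr1.
- by apply: le_trans (WL L); rewrite lef_pV2 ?posrE//; exact: lt_le_trans D0.
Qed.

(** [D^-1] bounds the leak over the right wall, the ascent from [x] to [x + k]. On the left,
    [weight_decay] bounds [W x] and makes [W (- L)] exponentially large, whence the term
    [B * q ^+ L]. *)
Lemma return_prob_lower (R : realType) (w : environment R) (c b r C : R) m :
  0 < c -> (forall y, c <= w y <= 1 - c) -> 0 < b ->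
  barrier_profile w b r C m ->
  exists B q : R, [/\ 0 < B, 0 < q < 1 & forall (d D : R) (n L x k : nat),
    0 < D -> (x + k < L)%N -> (L <= n)%N ->
    D <= \prod_(i < k) rho w (x + i.+1)%N%:Z ->
    D^-1 + B * q ^+ L <= d -> d <= 1 ->
    c ^+ (2 * L) * (1 - d) ^+ (2 * n) <= return_prob w (2 * n) 0].
Proof.
move=> c0 cw b0 [/andP[r0 r1] m1 mC mr].
have C0 : 0 < C.
  have := le_trans (m1 0) (mC 0); rewrite absz0 powR1 mulr1.
  by apply: lt_le_trans.
have [W [W0 W_gt0 WS0]] := int_geometric_primitive (fun x => rho_gt0 w (x + 1)).
have WS : forall x, W (x + 1) = rho w (x + 1) * W x by [].
have [H H0 HS] := int_primitive W.
have [B1 B1_gt0 hB1] := powR_geometric_bounded b0 (ltac:(by rewrite r0) : 0 < r < 1).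
exists (C * B1 * C), r; split; [by rewrite !mulr_gt0|by rewrite r0|].
move=> d D n L x k D0 xkL Ln DW dD d1.
have m0 : m 0 <= C by have := mC 0; rewrite absz0 powR1 mulr1.
apply: (return_prob_trap W_gt0 WS HS c0 cw (leq_addr k x) xkL) => //.
apply: le_trans dD; apply: lerD.
  have -> : W (x + k)%N = W x * \prod_(i < k) rho w (x + i.+1)%N%:Z.
    elim: k {xkL DW} => [|k IH]; first by rewrite addn0 big_ord0 mulr1.
    have -> : (x + k.+1)%N%:Z = (x + k)%N%:Z + 1 by lia.
    rewrite WS big_ord_recr/= IH mulrCA; congr (_ * _); rewrite mulrC.
    by congr (_ * rho w _); lia.
  rewrite invfM mulrA mulfV ?gt_eqF// mul1r lef_pV2 ?posrE//.
  exact: lt_le_trans DW.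
have hx : W x <= C * B1.
  have := weight_decay W_gt0 WS mr (ltW r0) x x; rewrite subrr W0 mulr1 => h.
  have : W x * 1 <= r ^+ x * m x by apply: le_trans h; rewrite ler_pM2l.
  rewrite mulr1 => /le_trans; apply.
  apply: le_trans (ler_wpM2l (exprn_ge0 _ (ltW r0)) (mC x)) _.
  rewrite mulrCA ler_pM2l// absz_nat mulrC; exact: hB1.
have hL : (W (- L%:Z))^-1 <= C * r ^+ L.
  have := weight_decay W_gt0 WS mr (ltW r0) 0 L; rewrite W0 mul1r sub0r => h.
  have : 1 <= r ^+ L * C * W (- L%:Z).
    apply: le_trans (m1 _) (le_trans h _).
    by rewrite ler_pM2r// ler_pM2l// exprn_gt0.
  by rewrite -ler_pdivrMr// div1r [C * _]mulrC.
by rewrite -[leRHS]mulrA; apply: ler_pM => //; rewrite ?invr_ge0 ltW.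
Qed.

(** * Independence *)

Lemma indep_g_sigma_algebra d (T : measurableType d) (R : realType)
    (P : probability T R) (G : set (set T)) (B : set T) :
  setI_closed G -> G `<=` measurable -> measurable B ->
  (forall A, G A -> P (A `&` B) = (P A * P B)%E) ->
  forall A, <<s G >> A -> P (A `&` B) = (P A * P B)%E.
Proof.
move=> GI Gm mB GB.
have sm A : <<s G >> A -> measurable A.
  by apply: smallest_sub => //; exact: sigma_algebra_measurable.
apply: (@dynkin_induction _ (g_sigma_algebraType G)) => //.
- by rewrite setTI probability_setT mul1e.
- move=> A mA PA; have mA' := sm _ mA.
  have -> : ~` A `&` B = B `\` A by rewrite setDE setIC.
  rewrite measureD//; last by rewrite ltey_eq fin_num_measure.
  rewrite probability_setC// muleBl//; last exact: fin_num_measure.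
  by rewrite mul1e; congr (_ - _)%E; rewrite setIC; exact: PA.
- move=> F mF tF PF; have mF' n := sm _ (mF n).
  rewrite setI_bigcupl !measure_bigcup//.
  + transitivity (\sum_(0 <= i <oo | i \in [set: nat]) (P B * P (F i)))%E.
      by apply: eq_eseriesr => n _; rewrite muleC; exact: PF.
    have -> : P B = (fine (P B))%:E by rewrite fineK// fin_num_measure.
    rewrite nneseriesZl; last by move=> *; exact: measure_ge0.
    by rewrite muleC.
  + by move=> n _; exact: measurableI.
  + exact: trivIset_setIr.
Qed.

(** Independence identifies the joint law with the product of the marginals, and Tonelli applies
    since [f] and [g] are nonnegative. *)
Lemma expectation_prod_indep d d1 d2 (T : measurableType d)
    (T1 : measurableType d1) (T2 : measurableType d2) (R : realType)
    (P : probability T R) (X : {mfun T >-> T1}) (Z : {mfun T >-> T2})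
    (f : T1 -> R) (g : T2 -> R) :
  (forall A B, measurable A -> measurable B ->
    P (X @^-1` A `&` Z @^-1` B) = (P (X @^-1` A) * P (Z @^-1` B))%E) ->
  measurable_fun [set: T1] f -> measurable_fun [set: T2] g ->
  (forall x, 0 <= f x) -> (forall x, 0 <= g x) ->
  ('E_P[fun t => (f (X t) * g (Z t))%R] = 'E_P[f \o X] * 'E_P[g \o Z])%E.
Proof.
move=> indXZ mf mg f0 g0.
have mXZ : measurable_fun [set: T] (fun t => (X t, Z t)).
  exact: measurable_fun_pair.
pose XZ : {mfun T >-> (T1 * T2)%type} :=
  HB.pack (fun t : T => (X t, Z t)) (isMeasurableFun.Build _ _ _ _ _ mXZ).
pose p : T1 * T2 -> \bar R := fun x => (f x.1 * g x.2)%:E.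
have mp : measurable_fun setT p.
  apply/measurable_EFinP; apply: measurable_funM.
    exact: (measurableT_comp mf measurable_fst).
  exact: (measurableT_comp mg measurable_snd).
have p0 x : (0 <= p x)%E by rewrite lee_fin mulr_ge0.
have mfE : measurable_fun [set: T1] (EFin \o f) by exact/measurable_EFinP.
have mgE : measurable_fun [set: T2] (EFin \o g) by exact/measurable_EFinP.
rewrite !unlock.
transitivity (\int[distribution P XZ]_x p x)%E.
  by rewrite ge0_integral_distribution.
transitivity (\int[distribution P X \x distribution P Z]_x p x)%E.
  apply: eq_measure_integral => A mA _; apply/esym.
  by apply: product_measure_unique => // B C mB mC; exact: indXZ.
rewrite fubini_tonelli1// /fubini_F /p /=.
transitivity (\int[distribution P X]_x
    ((f x)%:E * \int[distribution P Z]_y (g y)%:E))%E.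
  apply: eq_integral => x _.
  by under eq_integral do rewrite EFinM; rewrite ge0_integralZl// => *; rewrite lee_fin.
have ig0 : (0 <= \int[distribution P Z]_y (g y)%:E)%E.
  by apply: integral_ge0 => y _; rewrite lee_fin.
under eq_integral do rewrite muleC.
rewrite ge0_integralZl//; last by move=> x _; rewrite lee_fin.
rewrite muleC; congr (_ * _)%E.
  by rewrite (ge0_integral_distribution X).
by rewrite (ge0_integral_distribution Z).
Qed.

Section independence.
Context d (T : measurableType d) d' (T' : measurableType d') (R : realType).
Context (I : choiceType) (P : probability T R) (Y : I -> T -> T').
Hypothesis mY : forall i, measurable_fun [set: T] (Y i).

Definition cylinders (S : set I) : set (set T) :=
  [set A | exists (J : {fset I}) (B : I -> set T'),
    [/\ forall i, i \in J -> S i, forall i, measurable (B i) &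
        A = [set t | forall i, i \in J -> B i (Y i t)]]].

(** A second measurable structure on the carrier of [T], so that depending only on the coordinates
    in [S] is expressed as measurability. *)
Definition sub_sigma (S : set I) := g_sigma_algebraType (cylinders S).

Lemma cylinders_setI S : setI_closed (cylinders S).
Proof.
move=> _ _ [J [B [JS mB ->]]] [K [C [KS mC ->]]].
exists (J `|` K)%fset, (fun i => (if i \in J then B i else setT) `&`
  (if i \in K then C i else setT)); split.
- by move=> i; rewrite inE => /orP[/JS|/KS].
- by move=> i; apply: measurableI; case: ifP.
- apply/seteqP; split => t /=.
    by move=> [tB tC] i _; split; case: ifP => //; [move/tB|move/tC].
  by move=> h; split=> i iJ; have := h i; rewrite inE iJ ?orbT => /(_ isT) [].
Qed.

Lemma cylinders_measurable S : cylinders S `<=` measurable.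
Proof.
move=> _ [J [B [_ mB ->]]].
have -> : [set t | forall i, i \in J -> B i (Y i t)] =
    \big[setI/setT]_(i <- J) (Y i @^-1` B i).
  rewrite -bigcap_seq; apply/seteqP; split => t /= h i /=; first exact: h.
  by move=> iJ; exact: h.
by apply: bigsetI_measurable => i _; rewrite -[X in measurable X]setTI; exact: mY.
Qed.

Lemma sub_sigma_measurable S (A : set (sub_sigma S)) :
  measurable A -> measurable (A : set T).
Proof.
apply: smallest_sub; first exact: sigma_algebra_measurable.
exact: cylinders_measurable.
Qed.

Lemma sub_sigma_measurable_fun S d0 (V : measurableType d0) (f : T -> V) :
  measurable_fun [set: sub_sigma S] f -> measurable_fun [set: T] f.
Proof.
move=> mf _ B mB; rewrite setTI.
by apply: (@sub_sigma_measurable S); rewrite -[X in measurable X]setTI; exact: mf.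
Qed.

Lemma sub_sigma_coord S i : S i -> measurable_fun [set: sub_sigma S] (Y i).
Proof.
move=> Si _ B mB; rewrite setTI; apply: sub_sigma_algebra.
exists [fset i]%fset, (fun=> B); split=> //.
  by move=> j; rewrite inE => /eqP ->.
apply/seteqP; split => t /=; first by move=> h j; rewrite inE => /eqP ->.
by apply; rewrite inE.
Qed.

Hypothesis indepY : mutually_independent P Y.

Lemma indep_cylinders S1 S2 A B : S1 `&` S2 = set0 ->
  cylinders S1 A -> cylinders S2 B -> P (A `&` B) = (P A * P B)%E.
Proof.
move=> S12 [J [C [JS mC ->]]] [K [D [KS mD ->]]].
have JK i : i \in J -> i \in K = false.
  move=> iJ; apply/negP => iK.
  by have : set0 i by rewrite -S12; split; [exact: JS|exact: KS].
pose E i := if i \in J then C i else D i.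
have mE i : measurable (E i) by rewrite /E; case: ifP.
have -> : [set t | forall i, i \in J -> C i (Y i t)] `&`
    [set t | forall i, i \in K -> D i (Y i t)] =
    [set t | forall i, i \in (J `|` K)%fset -> E i (Y i t)].
  apply/seteqP; split => t /=.
    move=> [hC hD] i; rewrite inE /E; case: ifP => [iJ _|_ /= iK].
      exact: hC.
    exact: hD.
  move=> h; split=> i iJ; have := h i; rewrite inE iJ ?orbT /E.
    by move/(_ isT); rewrite iJ.
  by move/(_ isT); case: ifP => // /JK; rewrite iJ.
rewrite !indepY//.
have -> : (\prod_(i <- (J `|` K)%fset) P [set t | E i (Y i t)] =
    \prod_(i <- enum_fset J ++ enum_fset K) P [set t | E i (Y i t)])%E.
  apply: perm_big; apply: uniq_perm; rewrite ?fset_uniq//.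
    rewrite cat_uniq !fset_uniq /= andbT; apply/hasPn => i iK.
    by apply/negP => iJ; have := JK i iJ; rewrite iK.
  by move=> i; rewrite mem_cat inE.
rewrite big_cat/=; congr (_ * _)%E; apply: eq_big_seq => i iJ; rewrite /E.
  by rewrite iJ.
by case: ifP => // /JK; rewrite iJ.
Qed.

(** Cylinders over disjoint index sets are independent; the pi-lambda argument extends this one
    factor at a time, the other being held fixed. *)
Lemma indep_sub_sigma S1 S2 A B : S1 `&` S2 = set0 ->
  measurable (A : set (sub_sigma S1)) -> measurable (B : set (sub_sigma S2)) ->
  P (A `&` B) = (P A * P B)%E.
Proof.
move=> S12 mA mB.
apply: (indep_g_sigma_algebra (@cylinders_setI S1) (@cylinders_measurable S1) _ _ mA).
  exact: (sub_sigma_measurable mB).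
move=> C CC; rewrite setIC muleC.
apply: (indep_g_sigma_algebra (@cylinders_setI S2) (@cylinders_measurable S2) _ _ mB).
  exact: (cylinders_measurable CC).
by move=> D DD; rewrite setIC muleC; exact: indep_cylinders CC DD.
Qed.

Lemma expectation_prod_sub_sigma S1 S2 (f g : T -> R) : S1 `&` S2 = set0 ->
  measurable_fun [set: sub_sigma S1] f -> measurable_fun [set: sub_sigma S2] g ->
  (forall t, 0 <= f t) -> (forall t, 0 <= g t) ->
  ('E_P[fun t => (f t * g t)%R] = 'E_P[f] * 'E_P[g])%E.
Proof.
move=> S12 mf g_m f0 g0.
(* The identity into [sub_sigma S] is a random variable carrying all coordinates in [S], so two
   families reduce to two variables. *)
have mid S : measurable_fun [set: T] (id : T -> sub_sigma S).
  by move=> _ A mA; rewrite setTI; exact: (@sub_sigma_measurable S A).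
pose X S : {mfun T >-> sub_sigma S} :=
  HB.pack (id : T -> sub_sigma S) (isMeasurableFun.Build _ _ _ _ _ (mid S)).
apply: (@expectation_prod_indep _ _ _ _ _ _ _ P (X S1) (X S2)) => // A B mA mB.
exact: (indep_sub_sigma S12).
Qed.

End independence.

(** * Moments and ascents of the potential *)

Lemma nneseries_fin_le (R : realType) (u : nat -> R) (M : R) :
  (forall n, 0 <= u n) -> (forall N, \sum_(i < N) u i <= M) ->
  (\sum_(n <oo) (u n)%:E <= M%:E)%E.
Proof.
move=> u0 uM; apply: lime_le.
  by apply: is_cvg_nneseries => n _ _; rewrite lee_fin.
by apply: nearW => n; rewrite sumEFin lee_fin big_mkord.
Qed.

Lemma sum_powR_le (R : realType) (d : R) (N : nat) : 0 < d ->
  \sum_(i < N) i.+1%:R `^ (- (1 + d)) <= 1 + d^-1.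
Proof.
move=> d0.
have d0' : 0 <= d^-1 by rewrite invr_ge0 ltW.
(* Integral comparison in telescoping form; once the common power is factored out it follows from
   [1 + u <= expR u] and [ln (1 - x^-1) <= - x^-1]. *)
have step (n : nat) : n.+2%:R `^ (- (1 + d)) <=
    d^-1 * (n.+1%:R `^ (- d) - n.+2%:R `^ (- d)).
  set x : R := n.+2%:R; have x1 : 1 < x by rewrite ltr1n.
  have x0 : 0 < x by rewrite ltr0n.
  have -> : n.+1%:R = x - 1 :> R by rewrite /x -[in RHS]natr1 addrK.
  have xm0 : 0 < x - 1 by rewrite subr_gt0.
  rewrite opprD powRD; last by rewrite (gt_eqF x0) implybT.
  rewrite powR_inv1; last exact: ltW.
  rewrite [x^-1 * _]mulrC ler_pdivlMl//.
  have -> : d * (x `^ (- d) / x) = x `^ (- d) * (d / x) by ring.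
  have -> : (x - 1) `^ (- d) - x `^ (- d) =
      x `^ (- d) * (((x - 1) / x) `^ (- d) - 1).
    rewrite mulrBr mulr1 -powRM; [|exact: ltW|exact/ltW/divr_gt0]; congr (_ `^ _ - _).
    by rewrite mulrC divfK// gt_eqF.
  rewrite ler_pM2l ?powR_gt0//.
  have y0 : 0 < (x - 1) / x by rewrite divr_gt0.
  rewrite -[((x - 1) / x) `^ _]lnK ?posrE ?powR_gt0// ln_powR.
  apply: le_trans (_ : - d * ln ((x - 1) / x) <= _); last first.
    by have := expR_ge1Dx (- d * ln ((x - 1) / x)); lra.
  rewrite mulNr -mulrN ler_pM2l//.
  have := @le_ln1Dx R (- x^-1).
  have -> : 1 + - x^-1 = (x - 1) / x by rewrite mulrBl mulfV ?mul1r// gt_eqF.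
  move=> h; rewrite lerNr; apply: h.
  by rewrite ltrN2 invf_lt1.
suff : \sum_(i < N.+1) i.+1%:R `^ (- (1 + d)) <= 1 + d^-1 * (1 - N.+1%:R `^ (- d)).
  move=> h; apply: le_trans (_ : \sum_(i < N.+1) i.+1%:R `^ (- (1 + d)) <= _).
    by rewrite big_ord_recr lerDl powR_ge0.
  apply: le_trans h _; rewrite lerD2l ler_piMr// lerBlDr lerDl powR_ge0//.
elim: N => [|N IH]; first by rewrite big_ord1 !powR1 subrr mulr0 addr0.
rewrite big_ord_recr/=; apply: le_trans (lerD IH (step N)) _.
by rewrite le_eqVlt; apply/orP; left; apply/eqP; ring.
Qed.

Section environment_law.
Context (R : realType) (P : probability (env_space R) R).
Let Y (x : int) (w : environment R) : R := w x.

Lemma measurable_env_coord x : measurable_fun [set: env_space R] (Y x).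
Proof.
move=> _ B mB; rewrite setTI; apply: sub_sigma_algebra; exists x => //.
by exists B => //; rewrite setTI.
Qed.

Let env_sub S := @sub_sigma _ (env_space R) _ (measurableTypeR R) int Y S.

Lemma measurable_rho_powR S x (s : R) : S x ->
  measurable_fun [set: env_sub S] (fun w : environment R => rho w x `^ s).
Proof.
move=> Sx.
have mY : measurable_fun [set: env_sub S] (Y x) by exact: sub_sigma_coord.
have -> : (fun w : environment R => rho w x `^ s) =
    (fun w => ((1 - Y x w) * (Y x w) `^ (- 1)) `^ s).
  apply/funext => w; rewrite /rho powR_inv1//.
  by have /andP[/ltW] := omega_in01 w x.
apply: (measurableT_comp (measurable_powR s)).
apply: measurable_funM; first exact: measurable_funB.
exact: (measurableT_comp (measurable_powR (- 1))).
Qed.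

Lemma measurable_prod_rho S (z : nat -> int) k (s : R) :
  (forall i, (i < k)%N -> S (z i)) ->
  measurable_fun [set: env_sub S]
    (fun w : environment R => \prod_(i < k) rho w (z i) `^ s).
Proof.
elim: k => [|k IH] Sz.
  by under eq_fun do rewrite big_ord0; exact: measurable_cst.
under eq_fun do rewrite big_ord_recr/=.
apply: measurable_funM; first by apply: IH => i ik; apply: Sz; rewrite ltnW.
by apply: measurable_rho_powR; exact: Sz.
Qed.

Let env_subT S d0 (V : measurableType d0) (f : environment R -> V) :
  measurable_fun [set: env_sub S] f -> measurable_fun [set: env_space R] f.
Proof. by move=> mf; apply: sub_sigma_measurable_fun mf; exact: measurable_env_coord. Qed.

Hypothesis hiid : iid P Y.

Definition moment (s : R) := ('E_P[fun w : environment R => (rho w 0 `^ s)%R])%E.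

Lemma moment_shift s x :
  ('E_P[fun w : environment R => (rho w x `^ s)%R] = moment s)%E.
Proof.
pose phi (y : R) : \bar R := (((1 - y) * y `^ (- 1)) `^ s)%:E.
have mphi : measurable_fun [set: R] phi.
  apply/measurable_EFinP; apply: (measurableT_comp (measurable_powR s)).
  apply: measurable_funM; first exact: measurable_funB.
  exact: measurable_powR.
pose X x : {mfun env_space R >-> R} := HB.pack (Y x)
  (isMeasurableFun.Build _ _ _ _ _ (measurable_env_coord x)).
have e z : ('E_P[fun w : environment R => (rho w z `^ s)%R] =
    \int[distribution P (X z)]_y phi y)%E.
  rewrite ge0_integral_distribution//; last by move=> y; rewrite lee_fin powR_ge0.
  rewrite unlock; apply: eq_integral => w _; rewrite /phi /= /rho powR_inv1//.
  by have /andP[/ltW] := omega_in01 w z.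
rewrite /moment !e; apply: eq_measure_integral => B mB _.
by rewrite /distribution /pushforward /=; exact: (proj2 hiid).
Qed.

Lemma moment_prod (z : nat -> int) k (s : R) : injective z ->
  ('E_P[fun w : environment R => (\prod_(i < k) rho w (z i) `^ s)%R] =
   moment s ^+ k)%E.
Proof.
move=> zI; elim: k => [|k IH].
  under eq_fun do rewrite big_ord0.
  by rewrite expe0; exact: expectation_cst.
under eq_fun do rewrite big_ord_recr/=.
rewrite (@expectation_prod_sub_sigma _ (env_space R) _ (measurableTypeR R) R int P Y
  measurable_env_coord (proj1 hiid) [set z i | i in `I_k] [set z k]).
- by rewrite IH moment_shift expeS muleC.
- apply/seteqP; split => // x /= [[i /= ik <-] /zI ik'].
  by move: ik; rewrite ik' ltnn.
- by apply: measurable_prod_rho => i ik; exists i.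
- exact: measurable_rho_powR.
- by move=> w; apply: prodr_ge0 => i _; exact: powR_ge0.
- by move=> w; exact: powR_ge0.
Qed.

Variables (kappa : R).
Hypothesis kappa_gt0 : 0 < kappa.
Hypothesis hkappa : moment kappa = 1%E.
Hypothesis hlt : (0 < P [set w : environment R | (w 0 < 2^-1)%R])%E.

(** Apply [ln z <= z - 1] to [y / A] with weight [t] and to [A^-1] with weight [1 - t]: the
    right-hand sides add up to 0, and the first inequality is strict because [y != 1] forces
    [y != A]. *)
Let weighted_amgm (t y : R) : 0 < t < 1 -> 0 < y -> y != 1 ->
  y `^ t < 1 - t + t * y.
Proof.
move=> /andP[t0 t1] y0 y1; set A := _ + _.
have A0 : 0 < A by rewrite addr_gt0 ?subr_gt0// mulr_gt0.
rewrite -[y `^ t]lnK ?posrE ?powR_gt0// ln_powR -[A]lnK ?posrE// ltr_expR.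
have lt_ln (z : R) : 0 < z -> z != 1 -> ln z < z - 1.
  move=> z0 z1; rewrite -ltr_expR lnK ?posrE//.
  by have := @expR_gt1Dx R (z - 1); rewrite subr_eq0 z1 addrC subrK; apply.
have le_ln (z : R) : 0 < z -> ln z <= z - 1.
  move=> z0; have [->|z1] := eqVneq z 1; first by rewrite ln1 subrr.
  exact/ltW/lt_ln.
have yA : y / A != 1.
  rewrite -subr_eq0; have -> : y / A - 1 = (y - A) / A.
    by rewrite mulrBl mulfV// gt_eqF.
  have -> : y - A = (1 - t) * (y - 1) by rewrite /A; ring.
  by rewrite !mulf_eq0 !subr_eq0 invr_eq0 (gt_eqF t1) (negbTE y1) (gt_eqF A0).
have h1 : t * ln (y / A) < t * (y / A - 1) by rewrite ltr_pM2l// lt_ln// divr_gt0.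
have h2 : (1 - t) * ln A^-1 <= (1 - t) * (A^-1 - 1).
  by rewrite ler_pM2l ?subr_gt0// le_ln// invr_gt0.
have h3 : t * (y / A - 1) + (1 - t) * (A^-1 - 1) = 0.
  have -> : t * (y / A - 1) + (1 - t) * (A^-1 - 1) = A / A - 1 by rewrite /A; ring.
  by rewrite mulfV ?subrr// gt_eqF.
move: h1 h2 h3; rewrite lnM ?posrE ?invr_gt0// lnV ?posrE// => h1 h2 h3.
lra.
Qed.

Let rho0_gt0 (w : environment R) x : 0 < rho w x.
Proof. exact: rho_gt0. Qed.

(** Strict Jensen for the concave power [s / kappa], applied to the variable [y] of mean 1. The gap
    [D] is nonnegative, and positive where [w 0 < 1/2], since [rho w 0 > 1] there. *)
Lemma moment_lt1 (s : R) : 0 < s < kappa -> (moment s < 1)%E.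
Proof.
move=> /andP[s0 sk].
pose t := s / kappa.
have t0 : 0 < t by rewrite divr_gt0.
have t1 : t < 1 by rewrite ltr_pdivrMr// mul1r.
pose y (w : environment R) := rho w 0 `^ kappa.
have y0 w : 0 < y w by exact: powR_gt0.
have yt w : rho w 0 `^ s = y w `^ t.
  by rewrite /y -powRrM /t [kappa * _]mulrC divfK// gt_eqF.
pose D (w : environment R) := 1 - t + t * y w - y w `^ t.
have D0 w : 0 <= D w.
  rewrite subr_ge0; have [->|y1] := eqVneq (y w) 1.
    by rewrite powR1 mulr1 subrK.
  by apply/ltW/weighted_amgm => //; rewrite t0.
have mrho u : measurable_fun [set: env_space R] (fun w : environment R => rho w 0 `^ u).
  by apply: (@env_subT [set 0]); exact: measurable_rho_powR.
have myt : measurable_fun [set: env_space R] (fun w => y w `^ t).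
  by under eq_fun do rewrite -yt; exact: mrho.
have mA : measurable_fun [set: env_space R] (fun w => 1 - t + t * y w).
  by apply: measurable_funD => //; apply: measurable_funM => //; exact: mrho.
have mD : measurable_fun [set: env_space R] D by exact: measurable_funB.
(* Stated as a sum, since [moment s] is not yet known to be finite. *)
have sumE : (moment s + \int[P]_w (D w)%:E = 1)%E.
  rewrite /moment unlock -ge0_integralD//; last 4 first.
  - by move=> w _; rewrite lee_fin powR_ge0.
  - by apply/measurable_EFinP; exact: mrho.
  - by move=> w _; rewrite lee_fin.
  - exact/measurable_EFinP.
  transitivity (\int[P]_w ((1 - t)%:E + t%:E * (y w)%:E))%E.
    apply: eq_integral => w _; rewrite -EFinM -!EFinD yt /D.
    by congr _%:E; ring.
  rewrite ge0_integralD//; last 3 first.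
  - by move=> w _; rewrite lee_fin subr_ge0 ltW.
  - by move=> w _; rewrite -EFinM lee_fin mulr_ge0// ltW.
  - apply/measurable_EFinP; apply: measurable_funM => //; exact: mrho.
  rewrite ge0_integralZl_EFin//; last 3 first.
  - by move=> w _; rewrite lee_fin ltW.
  - by apply/measurable_EFinP; exact: mrho.
  - exact: ltW.
  move: hkappa; rewrite /moment unlock => ->.
  have := @expectation_cst _ _ R P (1 - t); rewrite unlock => ->.
  rewrite mule1 -EFinD.
  by congr _%:E; ring.
have Dpos : (0 < \int[P]_w (D w)%:E)%E.
  rewrite lt_neqAle integral_ge0 ?andbT; last by move=> w _; rewrite lee_fin.
  apply/negP => /eqP/esym iD0.
  have : ae_eq P setT (EFin \o D) (cst 0%E).
    apply/ae_eq_integral_abs => //; first exact/measurable_EFinP.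
    by rewrite -[RHS]iD0; apply: eq_integral => w _; rewrite /= ger0_norm.
  move=> [N [mN PN0 DN]].
  suff : (P [set w : environment R | (w 0 < 2^-1)%R] <= P N)%E.
    by rewrite PN0 leNgt hlt.
  apply: le_measure; rewrite ?inE//.
    rewrite -[X in measurable X]setTI.
    have -> : [set w : environment R | w 0 < 2^-1] = Y 0 @^-1` `]-oo, 2^-1[%classic.
      by apply/seteqP; split => w /=; rewrite in_itv.
    exact: measurable_env_coord.
  move=> w /= w12; apply: DN => /= /(_ Logic.I) [] /eqP.
  rewrite gt_eqF// subr_gt0; apply: weighted_amgm; rewrite ?t0//.
  rewrite gt_eqF//; apply: lt_le_trans (_ : 1 + kappa * ln (rho w 0) <= _).
    rewrite ltrDl mulr_gt0// ln_gt0// /rho.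
    have /andP[w00 _] := omega_in01 w 0.
    by rewrite ltr_pdivlMr// mul1r; lra.
  rewrite -[y w]lnK ?posrE// /y ln_powR.
  exact: expR_ge1Dx.
have m0 : (0 <= moment s)%E.
  by apply: expectation_ge0 => w; exact: powR_ge0.
rewrite ltNge; apply/negP => m1.
have : (1 < moment s + \int[P]_w (D w)%:E)%E.
  apply: lt_le_trans (leeD2r _ m1).
  by rewrite lteDl.
by rewrite sumE ltxx.
Qed.

End environment_law.

(** * Almost sure barrier profiles *)

Lemma barrier_profile_of_products (R : realType) (w : environment R) (b r C : R) :
  0 < r < 1 ->
  (forall (x : int) (k : nat),
    \prod_(i < k) rho w (x - i%:Z) <= C * `|x|%N.+1%:R `^ b * r ^+ k) ->
  exists m, barrier_profile w b r C m.
Proof.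
move=> /andP[r0 r1] hC.
(* The profile is the supremum of the rescaled products that end at [x]. The empty product gives
   [1 <= m x]; extending a product that ends at [x - 1] by [rho w x] gives the recursion, at the
   price of one factor [r]. *)
pose A (x : int) := [set y : R | exists k : nat,
  y = (\prod_(i < k) rho w (x - i%:Z)) / r ^+ k].
have A_ub x : ubound (A x) (C * `|x|%N.+1%:R `^ b).
  by move=> _ [k ->]; rewrite ler_pdivrMr ?exprn_gt0.
have A1 x : A x 1 by exists 0%N; rewrite big_ord0 expr0 divr1.
have hA x : has_sup (A x).
  by split; [exists 1|exists (C * `|x|%N.+1%:R `^ b); exact: A_ub].
exists (fun x => sup (A x)); split.
- by rewrite r0.
- by move=> x; apply: (sup_upper_bound (hA x)).
- by move=> x; apply: ge_sup; [exists 1|exact: A_ub].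
- move=> x; rewrite mulrC -ler_pdivlMr ?rho_gt0//.
  apply: ge_sup; first by exists 1.
  move=> _ [k ->]; rewrite ler_pdivlMr ?rho_gt0//.
  have : (\prod_(i < k.+1) rho w (x - i%:Z)) / r ^+ k.+1 <= sup (A x).
    by apply: (sup_upper_bound (hA x)); exists k.+1.
  rewrite -(ler_pM2l r0); apply: le_trans; rewrite le_eqVlt; apply/orP; left.
  apply/eqP; rewrite big_ord_recl subr0 exprS.
  have -> : \prod_(i < k) rho w (x - 1 - i%:Z) =
      \prod_(i < k) rho w (x - (lift ord0 i)%:Z).
    by apply: eq_bigr => i _; congr rho; rewrite /= /bump /=; lia.
  by field; rewrite expf_neq0 gt_eqF.
Qed.

Lemma nneseries_ge_term (R : realType) (u : nat -> \bar R) n :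
  (forall k, (0 <= u k)%E) -> (u n <= \sum_(k <oo) u k)%E.
Proof.
move=> u0; apply: le_trans (nneseries_lim_ge n.+1 _) => //.
by rewrite big_nat_recr//= leeDr// sume_ge0.
Qed.

Lemma sum_geometric_le (R : realFieldType) (q : R) N : 0 <= q < 1 ->
  \sum_(i < N) q ^+ i <= (1 - q)^-1.
Proof.
move=> /andP[q0 q1].
rewrite -[leRHS]mul1r ler_pdivlMr ?subr_gt0//.
by have := subrX1 q N; have := exprn_ge0 N q0; lra.
Qed.

Lemma int_absz_cases (x : int) : x = `|x|%N%:Z \/ x = - `|x|%N%:Z.
Proof. lia. Qed.

(** A weighted sum [Z] of the [s]-th powers of all products has finite mean, hence is almost surely
    finite, and bounds each of its terms. Summing over sites asks for [b * s > 1], summing over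
    lengths for [s < kappa]; both can be met because [b > 1 / kappa]. *)
Lemma barrier_profile_ae (R : realType) (P : probability (env_space R) R)
    (kappa b : R) :
  iid P (fun (x : int) (w : environment R) => w x) -> 0 < kappa ->
  moment P kappa = 1%E -> (0 < P [set w : environment R | (w 0 < 2^-1)%R])%E ->
  kappa^-1 < b ->
  {ae P, forall w : environment R, exists r C m, barrier_profile w b r C m}.
Proof.
move=> hiid kappa0 hkappa hlt kb.
have ki0 : 0 < kappa^-1 by rewrite invr_gt0.
have b0 : 0 < b by exact: lt_trans kb.
have bk : b^-1 < kappa by rewrite -[ltRHS]invrK ltf_pV2.
have bi0 : 0 < b^-1 by rewrite invr_gt0.
pose s := (b^-1 + kappa) / 2.
have s1 : b^-1 < s by rewrite /s; lra.
have s2 : s < kappa by rewrite /s; lra.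
have s0 : 0 < s by lra.
pose d := b * s - 1.
have d0 : 0 < d.
  by rewrite subr_gt0 -(mulfV (lt0r_neq0 b0)) ltr_pM2l.
have mlt : (moment P s < 1)%E.
  by apply: (moment_lt1 kappa0 hkappa hlt); rewrite s0.
have mge : (0 <= moment P s)%E.
  by apply: expectation_ge0 => w; exact: powR_ge0.
pose e := fine (moment P s).
have eE : moment P s = e%:E.
  by rewrite /e fineK// ge0_fin_numE// (lt_le_trans mlt)// leey.
have e0 : 0 <= e by rewrite -lee_fin -eE.
have e1 : e < 1 by rewrite -lte_fin -eE.
(* Strictly between the moment [e] and 1, so that the ratio [e / r0] is summable over lengths; [r]
   undoes the [s]-th power. *)
pose r0 := (e + 1) / 2; pose r := r0 `^ s^-1.
have r00 : 0 < r0 by rewrite /r0; lra.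
have r01 : r0 < 1 by rewrite /r0; lra.
have er0 : e < r0 by rewrite /r0; lra.
have r_gt0 : 0 < r by exact: powR_gt0.
have rs : r `^ s = r0 by rewrite /r -powRrM mulVf ?powRr1 ?ltW// gt_eqF.
have r_lt1 : r < 1.
  have := @gt0_ltr_powR R s^-1; rewrite invr_gt0 => /(_ s0 r0 1).
  by rewrite powR1; apply => //; rewrite nnegrE ltW.
pose q := e / r0.
have q0 : 0 <= q by rewrite divr_ge0// ltW.
have q1 : q < 1 by rewrite ltr_pdivrMr// mul1r.
pose A (x : int) k (w : environment R) := \prod_(i < k) rho w (x - i%:Z) `^ s.
pose wt n k : R := n.+1%:R `^ (- (1 + d)) / r0 ^+ k.
have wt0 n k : 0 <= wt n k.
  by rewrite divr_ge0 ?powR_ge0// exprn_ge0// ltW.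
(* Both [n] and [- n] enter, so that one series over the naturals covers all sites. *)
pose T n k (w : environment R) := wt n k * (A n%:Z k w + A (- n%:Z) k w).
have A0 x k w : 0 <= A x k w by apply: prodr_ge0 => i _; exact: powR_ge0.
have T0 n k w : 0 <= T n k w by rewrite mulr_ge0// addr_ge0.
have mA x k : measurable_fun [set: env_space R] (A x k).
  apply: (@sub_sigma_measurable_fun _ (env_space R) _ (measurableTypeR R) int
    (fun (x : int) (w : environment R) => w x) (@measurable_env_coord R) setT).
  exact: (@measurable_prod_rho R setT (fun i => x - i%:Z)).
have mT n k : measurable_fun [set: env_space R] (T n k).
  by apply: measurable_funM => //; exact: measurable_funD.
have EA x k : (\int[P]_w (A x k w)%:E = (e ^+ k)%:E)%E.
  have := @moment_prod R P hiid (fun i => x - i%:Z) k s.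
  rewrite unlock => ->; first by rewrite eE EFin_expe.
  by move=> i j /eqP; rewrite (inj_eq (addrI x)) eqr_opp => /eqP [].
have ET n k : (\int[P]_w (T n k w)%:E =
    (n.+1%:R `^ (- (1 + d)) * (2 * q ^+ k))%:E)%E.
  under eq_integral do rewrite /T EFinM EFinD.
  rewrite ge0_integralZl_EFin//; last 2 first.
  - by move=> w _; rewrite -EFinD lee_fin addr_ge0.
  - by apply/measurable_EFinP; exact: measurable_funD.
  rewrite ge0_integralD//; last 4 first.
  - by move=> w _; rewrite lee_fin.
  - exact/measurable_EFinP.
  - by move=> w _; rewrite lee_fin.
  - exact/measurable_EFinP.
  rewrite !EA -EFinD -EFinM /wt /q; congr _%:E.
  have -> : (e / r0) ^+ k = e ^+ k / r0 ^+ k by exact: expr_div_n.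
  move: (r0 ^+ k) (expf_neq0 k (lt0r_neq0 r00)) => z z0.
  by field.
pose F n (w : env_space R) := (\sum_(k <oo) (T n k w)%:E)%E.
pose Z (w : env_space R) := (\sum_(n <oo) F n w)%E.
have F0 n w : (0 <= F n w)%E by apply: nneseries_ge0 => k _ _; rewrite lee_fin.
have mF n : measurable_fun [set: env_space R] (F n).
  apply: ge0_emeasurable_sum => [k w _ _|k _]; first by rewrite lee_fin.
  exact/measurable_EFinP.
have mZ : measurable_fun [set: env_space R] Z.
  by apply: ge0_emeasurable_sum => [k w _ _|k _].
have Z0 w : (0 <= Z w)%E by apply: nneseries_ge0 => k _ _; exact: F0.
have EF n : (\int[P]_w F n w <= (2 / (1 - q) * n.+1%:R `^ (- (1 + d)))%:E)%E.
  rewrite integral_nneseries//; last 2 first.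
  - by move=> k; exact/measurable_EFinP.
  - by move=> k w _; rewrite lee_fin.
  rewrite (eq_eseriesr (fun k _ => ET n k)).
  apply: nneseries_fin_le => [k|N].
    by rewrite !mulr_ge0 ?powR_ge0 ?exprn_ge0.
  rewrite -mulr_sumr -mulr_sumr mulrC ler_wpM2r ?powR_ge0// ler_wpM2l//.
  by apply: sum_geometric_le; rewrite q0.
have EZ : (\int[P]_w Z w < +oo)%E.
  apply: (@le_lt_trans _ _ (2 / (1 - q) * (1 + d^-1))%:E); last exact: ltry.
  rewrite integral_nneseries//.
  apply: le_trans (lee_nneseries _ (fun n _ => EF n)) _.
    by move=> n _ _; exact: integral_ge0.
  have q10 : 0 <= 2 / (1 - q) by rewrite divr_ge0// subr_ge0 ltW.
  apply: nneseries_fin_le => [n|N]; first by rewrite mulr_ge0// powR_ge0.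
  by rewrite -mulr_sumr ler_wpM2l// sum_powR_le.
have iZ : P.-integrable setT Z.
  apply/integrableP; split=> //.
  by under eq_integral do rewrite gee0_abs//.
have := integrable_ae measurableT iZ.
apply: filterS => w /(_ Logic.I) Zfin.
pose zeta := fine (Z w).
have zE : Z w = zeta%:E by rewrite /zeta fineK.
have Tz n k : T n k w <= zeta.
  rewrite -lee_fin -zE.
  apply: le_trans (_ : F n w <= _)%E; last exact: nneseries_ge_term.
  by apply: (@nneseries_ge_term _ (fun k => (T n k w)%:E)) => ?; rewrite lee_fin.
have z0 : 0 <= zeta by apply: le_trans (Tz 0%N 0%N).
exists r, (zeta `^ s^-1).
apply: barrier_profile_of_products; first by rewrite r_gt0.
move=> x k.
pose Q := \prod_(i < k) rho w (x - i%:Z).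
have Q0 : 0 <= Q by apply: prodr_ge0 => i _; rewrite ltW// rho_gt0.
have QA : Q `^ s = A x k w.
  rewrite /Q /A; elim: k {Q Q0} => [|k IH]; first by rewrite !big_ord0 powR1.
  rewrite !big_ord_recr/= powRM ?IH//; last by rewrite ltW// rho_gt0.
  by apply: prodr_ge0 => i _; rewrite ltW// rho_gt0.
have Az : A x k w <= zeta * `|x|%N.+1%:R `^ (b * s) * r0 ^+ k.
  apply: le_trans (_ : A `|x|%N%:Z k w + A (- `|x|%N%:Z) k w <= _).
    have [->|->] := int_absz_cases x.
      by rewrite absz_nat lerDl.
    by rewrite abszN absz_nat lerDr.
  have := Tz `|x|%N k; rewrite /T /wt.
  have -> : b * s = 1 + d by rewrite /d addrC subrK.
  have p0 : 0 < `|x|%N.+1%:R `^ (1 + d) :> R by rewrite powR_gt0// ltr0n.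
  have rk0 : 0 < r0 ^+ k by rewrite exprn_gt0.
  rewrite powRN -invfM mulrC ler_pdivrMr ?mulr_gt0// mulrA.
  exact.
have QE : Q = A x k w `^ s^-1.
  by rewrite -QA -powRrM mulfV ?powRr1// lt0r_neq0.
rewrite -/Q QE.
have -> : zeta `^ s^-1 * `|x|.+1%:R `^ b * r ^+ k =
    (zeta * `|x|.+1%:R `^ (b * s) * r0 ^+ k) `^ s^-1.
  rewrite !powRM ?mulr_ge0 ?powR_ge0 ?exprn_ge0 ?(ltW r00)//.
  have -> : (`|x|.+1%:R `^ (b * s)) `^ s^-1 = `|x|.+1%:R `^ b :> R.
    by rewrite -powRrM mulfK// gt_eqF.
  congr (_ * _).
  by rewrite /r -powR_mulrn ?powR_ge0// -powR_mulrn ?(ltW r00)// -!powRrM mulrC.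
apply: ge0_ler_powR; rewrite ?nnegrE ?invr_ge0 ?(ltW s0)//.
by rewrite !mulr_ge0 ?powR_ge0 ?exprn_ge0 ?(ltW r00).
Qed.

(** * High ascents and traps *)

Definition ascent (R : realType) (w : environment R) (x : int) (k : nat) : R :=
  \prod_(i < k) rho w (x + i.+1%:Z).

(** The event that the first length at which the ascent from [x] reaches [h] exceeds [k]. Each
    recursive step adds one condition, which involves one new site; length 0, where the ascent is 1,
    is not tested. *)
Fixpoint low_ascent (R : realType) (h : R) (x : int) (k : nat)
    (w : environment R) : bool :=
  if k is j.+1 then low_ascent h x j w && (ascent w x j.+1 < h) else true.

Lemma low_ascent_le (R : realType) (h : R) x k (w : environment R) : 1 <= h ->
  low_ascent h x k w -> ascent w x k <= h.
Proof.
move=> h1; case: k => [_|k /= /andP[_ /ltW]//].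
by rewrite /ascent big_ord0.
Qed.

Lemma low_ascentPn (R : realType) (h : R) x k (w : environment R) :
  ~~ low_ascent h x k w -> exists2 j, (j <= k)%N & h <= ascent w x j.
Proof.
elim: k => // k IH /=; rewrite negb_and => /orP[/IH[j jk hj]|].
  by exists j => //; exact: leqW.
by rewrite -leNgt => hk; exists k.+1.
Qed.

Lemma ascent_gt0 (R : realType) (w : environment R) x k : 0 < ascent w x k.
Proof. by apply: prodr_gt0 => i _; exact: rho_gt0. Qed.

Lemma ascent_powR (R : realType) (w : environment R) x k (s : R) :
  \prod_(i < k) rho w (x + i.+1%:Z) `^ s = ascent w x k `^ s.
Proof.
elim: k => [|k IH]; first by rewrite /ascent !big_ord0 powR1.
rewrite big_ord_recr/= IH /ascent big_ord_recr/= powRM//; apply: ltW.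
  exact: ascent_gt0.
exact: rho_gt0.
Qed.

Lemma ae_probability1 d (T : measurableType d) (R : realType)
    (P : probability T R) (A : set T) :
  measurable A -> P A = 1%E -> {ae P, forall t, A t}.
Proof.
move=> mA PA; exists (~` A); split=> //; first exact: measurableC.
by rewrite probability_setC// PA subee.
Qed.

Lemma ae_imply d (T : measurableType d) (R : realType) (P : probability T R)
    (A B : T -> Prop) :
  (forall t, A t -> B t) -> {ae P, forall t, A t} -> {ae P, forall t, B t}.
Proof. by move=> AB; exact: filterS. Qed.

Lemma ae_conj d (T : measurableType d) (R : realType) (P : probability T R)
    (A B : T -> Prop) :
  {ae P, forall t, A t} -> {ae P, forall t, B t} -> {ae P, forall t, A t /\ B t}.
Proof. by move=> PA PB; apply: filterS2 PA PB. Qed.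

Section traps.
Context (R : realType) (P : probability (env_space R) R) (kappa c : R).
Let Y (x : int) (w : environment R) : R := w x.
Hypothesis hiid : iid P Y.
Hypothesis kappa_gt0 : 0 < kappa.
Hypothesis hkappa : moment P kappa = 1%E.
Hypothesis hlt : (0 < P [set w : environment R | (w 0 < 2^-1)%R])%E.
Hypothesis c_gt0 : 0 < c.
Hypothesis hell : forall x : int,
  P [set w : environment R | c <= w x <= 1 - c] = 1%E.

Let env_sub S := @sub_sigma _ (env_space R) _ (measurableTypeR R) int Y S.

Let env_sub_fun S d0 (V : measurableType d0) (f : environment R -> V) :
  measurable_fun [set: env_sub S] f -> measurable_fun [set: env_space R] f.
Proof.
by move=> mf; apply: sub_sigma_measurable_fun mf; exact: measurable_env_coord.
Qed.

Lemma ellipticity_ae :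
  {ae P, forall w : environment R, forall x, c <= w x <= 1 - c}.
Proof.
have h (x : int) : {ae P, forall w : environment R, c <= w x <= 1 - c}.
  apply: ae_probability1 (hell x).
  have -> : [set w : environment R | c <= w x <= 1 - c] =
      Y x @^-1` `[c, 1 - c]%classic.
    by apply/seteqP; split => w /=; rewrite in_itv.
  by rewrite -[X in measurable X]setTI; exact: measurable_env_coord.
have h1 : {ae P, forall w : environment R, forall n : nat, c <= w n%:Z <= 1 - c}.
  by apply: ae_foralln => n; exact: h.
have h2 : {ae P, forall w : environment R, forall n : nat, c <= w (- n%:Z) <= 1 - c}.
  by apply: ae_foralln => n; exact: h.
apply: ae_imply (ae_conj h1 h2) => w [w1 w2] x.
by have [->|->] := int_absz_cases x.
Qed.

Lemma measurable_ascent S x k : (forall i, (i < k)%N -> S (x + i.+1%:Z)) ->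
  measurable_fun [set: env_sub S] (fun w : environment R => ascent w x k).
Proof.
move=> Sx; have -> : (fun w : environment R => ascent w x k) =
    (fun w => \prod_(i < k) rho w (x + i.+1%:Z) `^ 1).
  by apply/funext => w; rewrite ascent_powR powRr1// ltW// ascent_gt0.
exact: (@measurable_prod_rho R S (fun i => x + i.+1%:Z)).
Qed.

Lemma measurable_low_ascent S h x k : (forall i, (i < k)%N -> S (x + i.+1%:Z)) ->
  measurable_fun [set: env_sub S] (fun w : environment R => low_ascent h x k w).
Proof.
elim: k => [|k IH] Sx /=; first exact: measurable_cst.
apply: measurable_and; first by apply: IH => i ik; apply: Sx; rewrite ltnW.
by apply: measurable_fun_ltr; [exact: measurable_ascent|exact: measurable_cst].
Qed.

Let stopped (h : R) x k (w : environment R) : R :=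
  if low_ascent h x k w then ascent w x k `^ kappa else (h / c) `^ kappa.

Let measurable_stopped S h x k : (forall i, (i < k)%N -> S (x + i.+1%:Z)) ->
  measurable_fun [set: env_sub S] (stopped h x k).
Proof.
move=> Sx; apply: measurable_fun_ifT; first exact: measurable_low_ascent.
  apply: (measurableT_comp (measurable_powR kappa)); exact: measurable_ascent.
exact: measurable_cst.
Qed.

(* [stopped] dominates the martingale ascent^kappa stopped when it exceeds h,
   since the overshoot is at most a factor 1 / c; hence it is a submartingale. *)
Lemma expectation_stopped_ge1 (h : R) x k : 1 <= h ->
  (1 <= 'E_P[stopped h x k])%E.
Proof.
move=> h1; have h0 : 0 <= h by exact: le_trans h1.
have hc0 : 0 <= h / c by rewrite divr_ge0// ltW.
elim: k => [|k IH].
  rewrite /stopped /=; under eq_fun do rewrite /ascent big_ord0 powR1.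
  by have := @expectation_cst _ _ R P 1; rewrite unlock => ->.
apply: le_trans IH _.
pose f (w : environment R) := if low_ascent h x k w then ascent w x k `^ kappa else 0.
pose g (w : environment R) := if low_ascent h x k w then 0 else (h / c) `^ kappa.
pose z : int := x + k.+1%:Z.
pose S1 : set int := [set x + i.+1%:Z | i in `I_k].
have f0 w : 0 <= f w by rewrite /f; case: ifP => // _; exact: powR_ge0.
have g0 w : 0 <= g w by rewrite /g; case: ifP => // _; exact: powR_ge0.
have S1k i : (i < k)%N -> S1 (x + i.+1%:Z) by move=> ik; exists i.
have mf1 : measurable_fun [set: env_sub S1] f.
  apply: measurable_fun_ifT; first exact: measurable_low_ascent.
    apply: (measurableT_comp (measurable_powR kappa)); exact: measurable_ascent.
  exact: measurable_cst.
have mf := env_sub_fun mf1.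
have mg : measurable_fun [set: env_space R] g.
  apply: (@env_sub_fun S1).
  apply: measurable_fun_ifT; first exact: measurable_low_ascent.
    exact: measurable_cst.
  exact: measurable_cst.
have mr1 : measurable_fun [set: env_sub [set z]]
    (fun w : environment R => rho w z `^ kappa) by exact: measurable_rho_powR.
have mr := env_sub_fun mr1.
(* The martingale step: [f] depends only on sites up to [x + k], hence is independent of [rho] at
   [z], whose moment of order [kappa] is 1. *)
have Ef : (\int[P]_w (f w * rho w z `^ kappa)%:E = \int[P]_w (f w)%:E)%E.
  have := @expectation_prod_sub_sigma _ (env_space R) _ (measurableTypeR R) R int P Y
    (@measurable_env_coord R) (proj1 hiid) S1 [set z] f (fun w => rho w z `^ kappa).
  rewrite moment_shift// hkappa mule1 unlock; apply=> //.
    apply/seteqP; split => // y [[i /= ik <-]] /eqP.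
    rewrite /z (inj_eq (addrI x)) => /eqP [] ik'.
    by move: ik; rewrite ik' ltnn.
  by move=> w; exact: powR_ge0.
have -> : ('E_P[stopped h x k] = \int[P]_w (f w)%:E + \int[P]_w (g w)%:E)%E.
  rewrite -ge0_integralD//; last 4 first.
  - by move=> w _; rewrite lee_fin.
  - exact/measurable_EFinP.
  - by move=> w _; rewrite lee_fin.
  - exact/measurable_EFinP.
  rewrite unlock; apply: eq_integral => w _; rewrite -EFinD /stopped /f /g.
  by case: ifP => _; rewrite ?addr0 ?add0r.
rewrite -Ef -ge0_integralD//; last 4 first.
- by move=> w _; rewrite lee_fin mulr_ge0// powR_ge0.
- by apply/measurable_EFinP; exact: measurable_funM.
- by move=> w _; rewrite lee_fin.
- exact/measurable_EFinP.
(* The comparison is almost sure only, since the overshoot bound [rho w z <= c^-1] comes from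
   ellipticity. *)
rewrite unlock; apply: ae_ge0_le_integral => //.
- by move=> w _; rewrite -EFinD lee_fin addr_ge0// mulr_ge0// powR_ge0.
- apply: emeasurable_funD; first by apply/measurable_EFinP; exact: measurable_funM.
  exact/measurable_EFinP.
- by move=> w _; rewrite lee_fin /stopped; case: ifP => _; exact: powR_ge0.
- apply/measurable_EFinP; apply: (@env_sub_fun setT); exact: measurable_stopped.
apply: ae_imply ellipticity_ae => w wc _.
rewrite -EFinD lee_fin /stopped /f /g /=.
case: ifP => lk /=; last by rewrite mul0r add0r.
rewrite addr0.
have -> : ascent w x k `^ kappa * rho w z `^ kappa = ascent w x k.+1 `^ kappa.
  by rewrite -!ascent_powR big_ord_recr.
case: ifP => // _.
apply: ge0_ler_powR; rewrite ?nnegrE ?(ltW kappa_gt0)//.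
  exact/ltW/ascent_gt0.
rewrite {1}/ascent big_ord_recr/=; apply: ler_pM.
- exact/ltW/ascent_gt0.
- exact/ltW/rho_gt0.
- exact: low_ascent_le.
- have /andP[c1 c2] := wc z; have /andP[w0 w1] := omega_in01 w z.
  rewrite /rho -[leRHS]div1r; apply: ler_pM; rewrite ?invr_ge0 ?(ltW w0)//.
  + by rewrite subr_ge0 ltW.
  + by rewrite lerBlDr lerDl ltW.
  + by rewrite lef_pV2.
Qed.

Lemma moment_half : exists2 e : R, 0 <= e < 1 & moment P (kappa / 2) = e%:E.
Proof.
have mlt : (moment P (kappa / 2) < 1)%E.
  by apply: (moment_lt1 kappa_gt0 hkappa hlt); rewrite divr_gt0//= ltr_pdivrMr// ltr_pMr// ltr1n.
have mge : (0 <= moment P (kappa / 2))%E.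
  by apply: expectation_ge0 => w; exact: powR_ge0.
have eE : moment P (kappa / 2) = (fine (moment P (kappa / 2)))%:E.
  by rewrite fineK// ge0_fin_numE// (lt_le_trans mlt)// leey.
by exists (fine (moment P (kappa / 2))) => //; rewrite -lee_fin -lte_fin -eE mge.
Qed.

(** On the low event the stopped value is at most [h ^ (kappa / 2)] times the ascent to the power
    [kappa / 2], with mean at most 1/2 for a long block. As the total mean is at least 1, the value
    [(h / c) ^ kappa] taken on the complement must supply the other half. *)
Lemma probability_low_ascent (h e : R) x k : 1 <= h ->
  moment P (kappa / 2) = e%:E -> h `^ (kappa / 2) * e ^+ k <= 2^-1 ->
  (P [set w : environment R | low_ascent h x k w] <=
   (1 - (2 * (h / c) `^ kappa)^-1)%:E)%E.
Proof.
move=> h1 eE he; set B := (h / c) `^ kappa.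
have h0 : 0 < h by exact: lt_le_trans h1.
have B0 : 0 < B by rewrite powR_gt0// divr_gt0.
set A := [set w | _].
have mlow := @env_sub_fun setT _ _ _ (@measurable_low_ascent setT h x k (fun _ _ => Logic.I)).
have mA : measurable (A : set (env_space R)).
  have -> : A = (fun w => low_ascent h x k w) @^-1` [set true].
    by apply/seteqP; split => w /=.
  by rewrite -[X in measurable X]setTI; exact: mlow.
have masc := @env_sub_fun setT _ _ _ (@measurable_ascent setT x k (fun _ _ => Logic.I)).
have mp : measurable_fun [set: env_space R]
    (fun w : environment R => ascent w x k `^ (kappa / 2)).
  exact: (measurableT_comp (measurable_powR (kappa / 2)) masc).
have zI : injective (fun i : nat => x + i.+1%:Z).
  by move=> i j /eqP; rewrite (inj_eq (addrI x)) => /eqP [].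
have Ep : (\int[P]_w (ascent w x k `^ (kappa / 2))%:E = (e ^+ k)%:E)%E.
  have := @moment_prod R P hiid (fun i => x + i.+1%:Z) k (kappa / 2) zI.
  rewrite eE -EFin_expe => <-; rewrite unlock; apply: eq_integral => w _.
  by rewrite -ascent_powR.
have key : (1 <= (h `^ (kappa / 2) * e ^+ k)%:E + B%:E * P (~` A))%E.
  apply: le_trans (expectation_stopped_ge1 x k h1) _.
  rewrite EFinM -Ep -ge0_integralZl_EFin//; last 3 first.
  - by move=> w _; rewrite lee_fin powR_ge0.
  - exact/measurable_EFinP.
  - exact: powR_ge0.
  have mCA : measurable (~` A : set (env_space R)) by exact: measurableC.
  rewrite -[~` A]setIT -integral_indic// -ge0_integralZl_EFin//; last 2 first.
  - by apply/measurable_EFinP; exact: measurable_indic.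
  - exact: ltW.
  rewrite -ge0_integralD//; last 4 first.
  - by move=> w _; rewrite -EFinM lee_fin mulr_ge0 ?powR_ge0.
  - by apply/measurable_EFinP; exact: measurable_funM.
  - by move=> w _; rewrite -EFinM lee_fin mulr_ge0// ltW.
  - by apply/measurable_EFinP; apply: measurable_funM => //; exact: measurable_indic.
  rewrite unlock; apply: ge0_le_integral => //.
  - by move=> w _; rewrite lee_fin /stopped; case: ifP => _; exact: powR_ge0.
  - apply/measurable_EFinP; apply: (@env_sub_fun setT); exact: measurable_stopped.
  - apply/measurable_EFinP; apply: measurable_funD; first exact: measurable_funM.
    by apply: measurable_funM => //; exact: measurable_indic.
  move=> w _; rewrite -!EFinM -EFinD lee_fin /stopped indicE.
  case: ifP => lk; last first.
    rewrite mem_set ?mulr1; last by rewrite /A /= lk.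
    by rewrite lerDr mulr_ge0// powR_ge0.
  rewrite memNset ?mulr0 ?addr0; last by move=> /(_ lk).
  have -> : kappa = kappa / 2 + kappa / 2 by field.
  rewrite powRD; last by rewrite (gt_eqF (ascent_gt0 _ _ _)) implybT.
  have -> : (kappa / 2 + kappa / 2) / 2 = kappa / 2 by field.
  rewrite ler_wpM2r ?powR_ge0//.
  apply: ge0_ler_powR; rewrite ?nnegrE ?(ltW h0) ?divr_ge0 ?(ltW kappa_gt0)//.
    exact/ltW/ascent_gt0.
  exact: low_ascent_le.
have PA := fineK (fin_num_measure P A mA).
move: key; rewrite probability_setC// -PA -EFinB -EFinM -EFinD !lee_fin => key.
have k2 : 2^-1 <= B * (1 - fine (P A)).
  by move: key he; set u := B * _; set a := _ * e ^+ k; lra.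
have : (2 * B)^-1 <= 1 - fine (P A).
  rewrite -(ler_pM2l B0); apply: le_trans k2; rewrite le_eqVlt.
  by apply/orP; left; apply/eqP; field; rewrite gt_eqF.
by lra.
Qed.

(** Block [j] involves the sites from [j * K + 1] to [(j + 1) * K], so distinct blocks are
    independent. *)
Let low_blocks (h : R) (K N : nat) : set (environment R) :=
  [set w | forall j, (j < N)%N -> low_ascent h (j * K)%N%:Z K w].

Let measurable_low_blocks (S : set int) h K N :
  (forall i, (i <= N * K)%N -> S i%:Z) ->
  measurable (low_blocks h K N : set (env_sub S)).
Proof.
move=> SN.
have -> : low_blocks h K N =
    \bigcap_(j in `I_N) [set w | low_ascent h (j * K)%N%:Z K w] by [].
case: N SN => [|N] SN.
  rewrite [X in measurable X](_ : _ = setT)//.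
  by apply/seteqP; split => // w _ j.
apply: bigcap_measurable; first by exists 0%N.
move=> j /= jN.
have -> : [set w : environment R | low_ascent h (j * K)%N%:Z K w] =
    (fun w => low_ascent h (j * K)%N%:Z K w) @^-1` [set true].
  by apply/seteqP; split => w /=.
have := @measurable_low_ascent S h (j * K)%N%:Z K.
move=> mlow; rewrite -[X in measurable X]setTI; apply: mlow => // i iK.
rewrite -PoszD; apply: SN; rewrite mulSn addnC.
apply: leq_add => //; apply: leq_mul => //.
Qed.

Lemma probability_low_blocks (h e : R) K N : 1 <= h ->
  moment P (kappa / 2) = e%:E -> h `^ (kappa / 2) * e ^+ K <= 2^-1 ->
  (P (low_blocks h K N) <= ((1 - (2 * (h / c) `^ kappa)^-1) ^+ N)%:E)%E.
Proof.
move=> h1 eE he; elim: N => [|N IH].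
  rewrite expr0; apply: le_trans (probability_le1 _ _) _ => //.
  exact: (sub_sigma_measurable (@measurable_env_coord R) (@measurable_low_blocks setT h K 0 _)).
pose S1 : set int := [set x | x <= (N * K)%N%:Z].
pose S2 : set int := [set x | (N * K)%N%:Z < x].
have S12 : S1 `&` S2 = set0.
  by apply/seteqP; split => // x /= [x1 x2]; move: (le_lt_trans x1 x2); rewrite ltxx.
pose B : set (environment R) := [set w | low_ascent h (N * K)%N%:Z K w].
have mB : measurable (B : set (env_sub S2)).
  have -> : B = (fun w => low_ascent h (N * K)%N%:Z K w) @^-1` [set true].
    by apply/seteqP; split => w /=.
  rewrite -[X in measurable X]setTI.
  apply: (@measurable_low_ascent S2 h (N * K)%N%:Z K) => // i iK.
  by rewrite /S2 /= ltrDl.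
have -> : low_blocks h K N.+1 = low_blocks h K N `&` B.
  apply/seteqP; split => w /=.
    by move=> hw; split=> [j jN|]; apply: hw => //; exact: leqW.
  by move=> [hw hB] j; rewrite ltnS leq_eqVlt => /orP[/eqP ->//|]; exact: hw.
have mL : measurable (low_blocks h K N : set (env_sub S1)).
  by apply: measurable_low_blocks => i; rewrite /S1 /= lez_nat.
rewrite (indep_sub_sigma (@measurable_env_coord R) (proj1 hiid) S12 mL mB).
rewrite exprSr EFinM; apply: lee_pmul => //.
exact: (probability_low_ascent _ h1 eE he).
Qed.

Lemma trap_ae : exists tau C : R, [/\ 1 < tau, 0 < C &
  {ae P, forall w : environment R, exists K0 : nat, forall K, (K0 <= K)%N ->
    exists x k : nat, (x + k)%:R <= C * K%:R ^+ 2 * (tau ^+ K) `^ kappa /\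
      tau ^+ K <= \prod_(i < k) rho w (x + i.+1)%N%:Z}].
Proof.
have [e /andP[e0 e1] eE] := moment_half.
(* Here [t > 1], [e * t < 1] and [tau] to the power [kappa / 2] is [t]. The condition on a block of
   length [K] at height [tau ^+ K] becomes [(e * t) ^+ K <= 2^-1], which holds for large [K]: blocks
   are only logarithmic in the height. *)
pose t := 2 / (1 + e); pose tau := t `^ (2 / kappa).
have t1 : 1 < t by rewrite ltr_pdivlMr; lra.
have t0 : 0 < t by exact: lt_trans t1.
have et : e * t < 1 by rewrite mulrA ltr_pdivrMr; lra.
have et0 : 0 <= e * t by rewrite mulr_ge0// ltW.
have kne : kappa != 0 by rewrite gt_eqF.
have tauk : tau `^ (kappa / 2) = t.
  rewrite /tau -powRrM; have -> : 2 / kappa * (kappa / 2) = 1 by field.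
  by rewrite powRr1// ltW.
have tau1 : 1 < tau.
  have := @gt0_ltr_powR R (2 / kappa); rewrite divr_gt0// => /(_ isT 1 t).
  by rewrite powR1; apply=> //; rewrite nnegrE ltW.
have tau0 : 0 < tau by exact: lt_trans tau1.
have tauK1 K : 1 <= tau ^+ K by rewrite exprn_ege1// ltW.
(* An event of probability 1 is nonempty: some environment is elliptic at 0. *)
have c1 : c <= 1.
  have [w wc] : exists w : environment R, c <= w 0 <= 1 - c.
    apply: contrapT => /forallNP h0.
    have := hell 0; rewrite [X in P X](_ : _ = set0) ?measure0.
      by move=> /eqP; rewrite lt_eqF// lte01.
    by apply/seteqP; split => // w; exact: h0.
  by have /andP[_ w1] := omega_in01 w 0; move: wc => /andP[+ _]; lra.
pose B K := (tau ^+ K / c) `^ kappa.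
have tc1 K : 1 <= tau ^+ K / c.
  by rewrite ler_pdivlMr// mul1r; apply: le_trans (tauK1 K).
have B1 K : 1 <= B K.
  have := @ge0_ler_powR R kappa (ltW kappa_gt0) 1 (tau ^+ K / c).
  by rewrite powR1; apply; rewrite ?nnegrE// (le_trans ler01).
have B0 K : 0 < B K by exact: lt_le_trans (B1 K).
(* A block contains a high ascent with probability at least [(2 * B K)^-1], so this many blocks all
   fail with probability at most [exp (- K)], which is summable. *)
pose N K := (Num.truncn (2 * B K * K%:R)).+1.
pose F K : set (env_space R) := low_blocks (tau ^+ K) K (N K).
have mF K : measurable (F K).
  exact: (sub_sigma_measurable (@measurable_env_coord R)
    (@measurable_low_blocks setT _ _ _ _)).
pose q := expR (- 1) : R.
have q0 : 0 < q by exact: expR_gt0.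
have q1 : q < 1 by rewrite /q expR_lt1; lra.
have [K1 hK1] : exists K1, forall K, (K1 <= K)%N -> (e * t) ^+ K <= 2^-1.
  have : (fun n => (e * t) ^+ n) @ \oo --> (0 : R).
    by apply: cvg_expr; rewrite ger0_norm.
  move=> /cvgrPdist_le /(_ 2^-1) []; first by rewrite invr_gt0.
  move=> K1 _ hK1; exists K1 => K /hK1 /=.
  by rewrite sub0r normrN ger0_norm// exprn_ge0.
(* The factor [q ^- K1] makes the bound trivial below [K1], so that it can be summed over all
   [K]. *)
have PF K : (P (F K) <= (q ^- K1 * q ^+ K)%:E)%E.
  have [K1K|KK1] := leqP K1 K; last first.
    apply: le_trans (probability_le1 _ (mF K)) _.
    rewrite lee_fin mulrC ler_pdivlMr ?exprn_gt0// mul1r.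
    by apply: ler_wiXn2l; rewrite ?(ltW q0) ?(ltW q1)// ltnW.
  apply: le_trans (probability_low_blocks (N K) (tauK1 K) eE _) _.
    rewrite -powR_mulrn ?(ltW tau0)// -powRrM [K%:R * _]mulrC powRrM tauk.
    by rewrite powR_mulrn ?(ltW t0)// -exprMn mulrC hK1.
  rewrite lee_fin -/(B K).
  have p01 : 0 <= 1 - (2 * B K)^-1.
    rewrite subr_ge0 invf_le1 ?mulr_gt0//.
    by have := B1 K; lra.
  apply: le_trans (_ : expR (- (2 * B K)^-1) ^+ (N K) <= _).
    by rewrite lerXn2r ?nnegrE ?expR_ge0//; exact: expR_ge1Dx.
  apply: le_trans (_ : q ^+ K <= _); last first.
    rewrite ler_peMl ?exprn_ge0 ?(ltW q0)// invf_ge1 ?exprn_gt0//.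
    by rewrite exprn_ile1 ?(ltW q0) ?(ltW q1).
  rewrite /q -!expRM_natl ler_expR mulrN mulrN1 lerN2.
  rewrite ler_pdivlMr ?mulr_gt0// mulrC.
  by apply/ltW/truncnS_gt.
exists tau, (3 * c `^ (- kappa)); split=> //; first by rewrite mulr_gt0// powR_gt0.
have lim0 : P (lim_sup_set F) = 0%E.
  apply: lim_sup_set_cvg0 => //.
  apply: (@le_lt_trans _ _ (q ^- K1 * (1 - q)^-1)%:E); last exact: ltry.
  apply: le_trans (lee_nneseries _ (fun n _ => PF n)) _ => //.
  have qK : 0 <= q ^- K1 by rewrite invr_ge0 exprn_ge0// ltW.
  apply: nneseries_fin_le => [n|M]; first by rewrite mulr_ge0// exprn_ge0// ltW.
  by rewrite -mulr_sumr ler_wpM2l// sum_geometric_le// ltW.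
exists (lim_sup_set F); split=> //.
  by apply: bigcap_measurable => // k _; apply: bigcup_measurable.
move=> w; apply: contra_notP => hw.
have [n hn] : exists n, forall K, (n <= K)%N -> ~ F K w.
  apply: contrapT => /forallNP h; apply: hw => n _.
  have /existsNP[K /not_implyP[nK /contrapT FK]] := h n.
  by exists K.
(* With [1 <= K], the rounding in [N K] is covered by the constant 3. *)
exists (maxn 1 n) => K; rewrite geq_max => /andP[K_gt0 /hn].
move=> /existsNP[j /not_implyP[jN /negP /low_ascentPn [k kK hk]]].
exists (j * K)%N, k; split; last first.
  apply: le_trans hk _; rewrite /ascent le_eqVlt; apply/orP; left.
  by apply/eqP; apply: eq_bigr => i _; rewrite PoszD.
apply: le_trans (_ : (N K * K)%:R <= _).
  rewrite ler_nat (leq_trans (_ : _ <= j * K + K)%N) ?leq_add2l//.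
  by rewrite addnC -mulSn leq_mul2r jN orbT.
rewrite natrM; apply: le_trans (_ : 3 * B K * K%:R * K%:R <= _).
  rewrite ler_wpM2r// /N -natr1.
  have K1' : 1 <= K%:R :> R by rewrite ler1n.
  have BK1 : 1 <= B K * K%:R by rewrite mulr_ege1.
  have BK0 : 0 <= 2 * B K * K%:R by rewrite !mulr_ge0// ltW.
  have tB : (Num.truncn (2 * B K * K%:R))%:R <= 2 * B K * K%:R by rewrite truncn_le.
  by move: tB BK1; rewrite -!mulrA; lra.
have -> : B K = c `^ (- kappa) * (tau ^+ K) `^ kappa.
  rewrite /B powRM ?invr_ge0 ?(ltW c_gt0) ?exprn_ge0 ?(ltW tau0)//.
  by rewrite -powR_inv1 ?(ltW c_gt0)// -powRrM mulN1r mulrC.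
rewrite le_eqVlt; apply/orP; left; apply/eqP; ring.
Qed.

End traps.

(** * Asymptotics *)

Lemma expR_dominates (R : realType) (A d : R) : 0 < d ->
  exists Y : R, forall y, Y <= y -> A <= expR (d * y).
Proof.
move=> d0; exists (A / d) => y Ay.
apply: le_trans (expR_ge1Dx _).
have : A <= d * y by rewrite mulrC -ler_pdivrMr.
lra.
Qed.

Lemma sqr_le_expR (R : realType) (d y : R) : 0 < d -> 0 <= y ->
  y ^+ 2 <= 4 / d ^+ 2 * expR (d * y).
Proof.
move=> d0 y0.
have h : d * y / 2 <= expR (d * y / 2).
  by apply: le_trans (expR_ge1Dx _); lra.
have h0 : 0 <= d * y / 2 by rewrite divr_ge0// mulr_ge0// ltW.
have h2 : (d * y / 2) ^+ 2 <= expR (d * y).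
  have -> : expR (d * y) = expR (d * y / 2) ^+ 2.
    by rewrite -expRM_natl; congr expR; field.
  by rewrite lerXn2r// nnegrE// expR_ge0.
have -> : y ^+ 2 = 4 / d ^+ 2 * (d * y / 2) ^+ 2 by field; rewrite gt_eqF.
by rewrite ler_pM2l// divr_gt0// exprn_gt0.
Qed.

Lemma ln_1B_ge (R : realType) (d : R) : 0 <= d <= 2^-1 -> - (2 * d) <= ln (1 - d).
Proof.
move=> /andP[d0 d1]; have e0 : 0 < 1 - d by lra.
have h : ln (1 - d)^-1 <= (1 - d)^-1 - 1.
  have := @le_ln1Dx R ((1 - d)^-1 - 1).
  have -> : 1 + ((1 - d)^-1 - 1) = (1 - d)^-1 by ring.
  apply.
  by have : 0 < (1 - d)^-1 by [rewrite invr_gt0]; lra.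
have h2 : (1 - d)^-1 - 1 <= 2 * d.
  have -> : (1 - d)^-1 - 1 = d / (1 - d) by field; rewrite gt_eqF.
  by rewrite ler_pdivrMr//; nra.
by move: h; rewrite lnV ?posrE//; lra.
Qed.

(** Powers of [n] are written as exponentials in [ln n], so that constants and logarithmic factors
    are absorbed by comparing exponentials beyond a threshold on [ln n]. *)
Lemma ln_ratio_cvg (R : realType) (a : nat -> R) (theta : R) :
  (forall eps : R, 0 < eps -> exists Y : R, forall n : nat, (0 < n)%N ->
    Y <= ln n%:R ->
    expR ((theta - eps) * ln n%:R) <= a n <= expR ((theta + eps) * ln n%:R)) ->
  ln (a n) / ln n%:R @[n --> \oo] --> theta.
Proof.
move=> h; apply/cvgrPdist_le => eps eps0.
have [Y hY] := h eps eps0.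
pose Y1 := Num.max Y 1.
exists (Num.truncn (expR Y1)).+1 => // n /= hn.
have n0 : (0 < n)%N by exact: leq_trans hn.
have nY : Y1 <= ln n%:R.
  rewrite -[Y1]expRK ler_ln ?posrE ?expR_gt0 ?ltr0n//.
  apply: le_trans (ltW (truncnS_gt _)) _.
  by rewrite ler_nat.
move: nY; rewrite ge_max => /andP[nY n1].
have /andP[a1 a2] := hY n n0 nY.
have a0 : 0 < a n by apply: lt_le_trans a1; exact: expR_gt0.
have y0 : 0 < ln n%:R :> R by exact: lt_le_trans n1.
rewrite distrC ler_distl; apply/andP; split.
  by rewrite ler_pdivlMr// -[leLHS]expRK ler_ln ?posrE ?expR_gt0.
by rewrite ler_pdivrMr// -[leRHS]expRK ler_ln ?posrE ?expR_gt0.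
Qed.

Section asymptotics.
Context (R : realType) (w : environment R) (c kappa : R).
Hypothesis c_gt0 : 0 < c.
Hypothesis cw : forall x, c <= w x <= 1 - c.
Hypothesis kappa_gt0 : 0 < kappa.

Variable theta : R.
Hypothesis thetaE : theta = kappa / (kappa + 1).

Let k1_gt0 : 0 < kappa + 1. Proof. by rewrite addr_gt0. Qed.

Lemma return_prob_even_gt0 n : 0 < return_prob w (2 * n) 0.
Proof.
have := @return_prob_reach R w c (ltW c_gt0) cw (2 * n) 0.
rewrite normr0 => /(_ isT); rewrite addn0 mul2n odd_double => /(_ isT).
by apply: lt_le_trans; rewrite exprn_gt0.
Qed.

(** With [L] of order [n ^ g] and [g = (1 + b)^-1], the exponents [n * L ^ (- b)] and [L] in
    [return_prob_upper] have the same order. Half of [eps] pays for the excess of [b] over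
    [1 / kappa], the other half for the constants. *)
Lemma log_return_prob_ge (eps : R) : 0 < eps ->
  (forall b, kappa^-1 < b -> exists b', kappa^-1 < b' <= b /\
     exists r C m, barrier_profile w b' r C m) ->
  exists Y : R, forall n : nat, (0 < n)%N -> Y <= ln n%:R ->
    expR ((theta - eps) * ln n%:R) <= - ln (return_prob w (2 * n) 0).
Proof.
move=> eps0 hprof.
have aux1 (T G : R) : T - eps / 2 <= G -> eps / 2 + (T - eps) <= G by lra.
have aux2 (u l s t : R) : u <= l - 2 * s -> l <= s -> t <= s -> t <= - u by lra.
have ki0 : 0 < kappa^-1 by rewrite invr_gt0.
have [b [/andP[kb bk] [r [C [m prof]]]]] : exists b, kappa^-1 < b <= kappa^-1 + eps / 2 /\
     exists r C m, barrier_profile w b r C m.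
  by apply: hprof; rewrite ltrDl divr_gt0.
have b0 : 0 < b by exact: lt_trans kb.
have [a [B [q [a0 B0 /andP[q0 q1] up]]]] := return_prob_upper c_gt0 cw b0 prof.
have b10 : 0 < 1 + b by rewrite addr_gt0.
pose g := (1 + b)^-1; have g0 : 0 < g by rewrite invr_gt0.
have gth : theta - eps / 2 <= g.
  have e1 : theta = (1 + kappa^-1)^-1.
    rewrite thetaE; field; apply/andP; split; first by rewrite gt_eqF.
    by rewrite gt_eqF// addr_gt0.
  have k0 : 0 < 1 + kappa^-1 by rewrite addr_gt0.
  (* The inverses of [g] and [theta] differ by [b - kappa^-1], and both exponents are at most 1. *)
  have e2 : theta - g = (b - kappa^-1) * (theta * g).
    rewrite e1 /g; field.
    by rewrite !gt_eqF// addr_gt0.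
  have t1 : theta <= 1 by rewrite thetaE ler_pdivrMr// mul1r lerDl.
  have t0 : 0 <= theta by rewrite thetaE divr_ge0 ?ltW.
  have g1 : g <= 1 by rewrite invf_le1// lerDl ltW.
  have : (b - kappa^-1) * (theta * g) <= b - kappa^-1.
    by rewrite ler_piMr ?subr_ge0 ?(ltW kb)// mulr_ile1// ltW.
  by rewrite -e2; lra.
pose lq := - ln q; have lq0 : 0 < lq by rewrite oppr_gt0 ln_lt0// q0.
pose a1 := a * 2 * 2 `^ (- b); have a10 : 0 < a1 by rewrite !mulr_gt0// powR_gt0.
pose a2 := Num.min a1 lq; have a20 : 0 < a2 by rewrite lt_min a10.
(* The factor [q^-1] pays for rounding [X] down to [L]; in [a1], the power of 2 comes from
   [L + 1 <= 2 * X]. *)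
pose M := 1 + B / q; have M0 : 0 < M by rewrite addr_gt0// divr_gt0.
have [Y1 hY1] := @expR_dominates R (2 / a2 * ln M) g g0.
have [Y2 hY2] := @expR_dominates R (2 / a2) (eps / 2) (ltac:(by rewrite divr_gt0)).
exists (Num.max 0 (Num.max Y1 Y2)) => n n0; set y := ln _.
rewrite !ge_max => /and3P[y0 y1 y2].
have nE : n%:R = expR y :> R by rewrite lnK// posrE ltr0n.
pose X := expR (g * y); have X0 : 0 < X by exact: expR_gt0.
have X1 : 1 <= X by rewrite -expR0 ler_expR mulr_ge0// ltW.
pose L := Num.truncn X.
have LX : L%:R <= X by rewrite truncn_le ltW.
have XL : X < L.+1%:R by exact: truncnS_gt.
have L0 : (0 < L)%N by rewrite truncn_gt0.
have h1 : a1 * X <= a * (2 * n)%:R * L.+1%:R `^ (- b).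
  have -> : a1 * X = a * (2 * n)%:R * (2 * X) `^ (- b).
    rewrite powRM ?(ltW X0)// /a1 natrM nE.
    have -> : X `^ (- b) = expR (- b * (g * y)) by rewrite /X -expRM mulrC.
    have -> : expR y = X * expR (b * (g * y)).
      rewrite /X -expRD; congr expR; rewrite /g; field.
      by rewrite gt_eqF.
    have -> : expR (- b * (g * y)) = (expR (b * (g * y)))^-1 by rewrite mulNr expRN.
    by field; rewrite gt_eqF// expR_gt0.
  rewrite ler_pM2l ?mulr_gt0 ?ltr0n ?muln_gt0//.
  rewrite !powRN lef_pV2 ?posrE ?powR_gt0 ?ltr0n ?mulr_gt0//.
  apply: ge0_ler_powR; rewrite ?nnegrE ?(ltW b0) ?mulr_ge0 ?(ltW X0)//.
  by rewrite -natr1; lra.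
have h2 : q ^+ L <= q^-1 * expR (- (lq * X)).
  rewrite ler_pdivlMl// -exprS -[q ^+ _]lnK ?posrE ?exprn_gt0//.
  rewrite lnXn// ler_expR -mulr_natl /lq mulNr opprK mulrC.
  by rewrite ler_nM2l ?ln_lt0 ?q0// ltW.
have uX : return_prob w (2 * n) 0 <= M * expR (- (a2 * X)).
  apply: le_trans (up (2 * n)%N L L0) _.
  rewrite /M mulrDl mul1r; apply: lerD.
    rewrite ler_expR lerN2; apply: le_trans h1.
    by rewrite ler_pM2r// ge_min lexx.
  rewrite -mulrA ler_pM2l//; apply: le_trans h2 _.
  by rewrite ler_pM2l ?invr_gt0// ler_expR lerN2 ler_pM2r// ge_min lexx orbT.
have : ln (return_prob w (2 * n) 0) <= ln (M * expR (- (a2 * X))).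
  by rewrite ler_ln ?posrE ?mulr_gt0 ?expR_gt0// return_prob_even_gt0.
rewrite lnM ?posrE ?expR_gt0// expRK => hu.
have hM : ln M <= a2 / 2 * X.
  have := hY1 y y1; rewrite -/X -ler_pdivlMl ?divr_gt0// => /le_trans; apply.
  by rewrite invf_div.
have hE : expR ((theta - eps) * y) <= a2 / 2 * X.
  rewrite -[leRHS]mul1r.
  apply: le_trans (_ : (2 / a2)^-1 * (expR (eps / 2 * y) * expR ((theta - eps) * y)) <= _).
    rewrite ler_pdivlMl ?divr_gt0// ler_pM2r ?expR_gt0//; exact: hY2.
  rewrite invf_div mul1r ler_pM2l ?divr_gt0// -expRD ler_expR -mulrDl.
  by rewrite ler_wpM2r//; exact: aux1.
apply: aux2 hM hE; apply: le_trans hu _; rewrite le_eqVlt; apply/orP; left.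
by apply/eqP; field.
Qed.

(** One fixed [b] is enough, as the profile only supplies an exponentially high left wall. With
    [tau ^+ K] of order [n ^ (1 / (kappa + 1))], reaching the trap and surviving in it both cost an
    exponent of order [n ^ theta], up to powers of [ln n]. *)
Lemma log_return_prob_le (eps b tau Ct : R) (K0 : nat) :
  0 < eps -> 0 < b -> (exists r C m, barrier_profile w b r C m) ->
  1 < tau -> 0 < Ct ->
  (forall K, (K0 <= K)%N ->
    exists x k : nat, (x + k)%:R <= Ct * K%:R ^+ 2 * (tau ^+ K) `^ kappa /\
      tau ^+ K <= \prod_(i < k) rho w (x + i.+1)%N%:Z) ->
  exists Y : R, forall n : nat, (0 < n)%N -> Y <= ln n%:R ->
    - ln (return_prob w (2 * n) 0) <= expR ((theta + eps) * ln n%:R).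
Proof.
move=> eps0 b0 [r [C [m prof]]] tau1 Ct0 trap.
have aux1 (T d : R) : T + d < 1 -> 0 < 1 - T - d by lra.
have aux2 (A t E : R) : 2 * A * t <= E -> A * t <= 2^-1 * E by lra.
have aux3 (d : R) : d <= 2^-1 -> d <= 1 /\ 0 < 1 - d by move=> ?; split; lra.
have aux4 (lu L l N ld d A E D : R) : 2 * L * l + 2 * N * ld <= lu ->
    2 * N * - (2 * d) <= 2 * N * ld -> N * d <= A * E -> 2 * L * - l <= D * E ->
    - lu <= D * E + 4 * A * E.
  by move=> ? ? ? ?; nra.
have [A1 [q [A10 /andP[q0 q1] low]]] := return_prob_lower c_gt0 cw b0 prof.
have tau0 : 0 < tau by exact: lt_trans tau1.
(* Once [L >= M * K], [q ^+ L <= tau ^- K]: the left wall is as high as the right one, up to a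
   constant. *)
have [M hM] : exists M, q ^+ M <= tau^-1.
  have : (fun n => q ^+ n) @ \oo --> (0 : R).
    by apply: cvg_expr; rewrite ger0_norm// ltW.
  move=> /cvgrPdist_le /(_ tau^-1) []; first by rewrite invr_gt0.
  move=> M _ hM; exists M; have := hM M (leqnn _).
  by rewrite sub0r normrN ger0_norm// exprn_ge0// ltW.
have t0 : 0 < theta by rewrite thetaE divr_gt0.
have t1 : theta < 1 by rewrite thetaE ltr_pdivrMr// mul1r ltrDl.
pose lt := ln tau; have lt0 : 0 < lt by rewrite ln_gt0.
(* Before rounding, the height at [K = beta * ln n] is exactly [n ^ (1 / (kappa + 1))]. *)
pose beta := ((kappa + 1) * lt)^-1; have be0 : 0 < beta by rewrite invr_gt0 mulr_gt0.
(* [del] pays for the factor [K ^+ 2]; it leaves [eps - del] for the constants and keeps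
   [theta + del < 1], so that [L <= n]. *)
pose del := Num.min (eps / 2) ((1 - theta) / 2).
have d0 : 0 < del by rewrite lt_min !divr_gt0// subr_gt0.
have d1 : del < eps by rewrite gt_min; apply/orP; left; lra.
have d2 : theta + del < 1.
  rewrite -ltrBrDl gt_min; apply/orP; right.
  by rewrite ltr_pdivrMr// ltr_pMr ?subr_gt0// ltr1n.
have c1 : c < 1 by have /andP[_] := omega_in01 w 0; have /andP[] := cw 0; lra.
have lc0 : 0 < - ln c by rewrite oppr_gt0 ln_lt0// c_gt0.
pose C' := Ct + M%:R; have C'0 : 0 < C' by rewrite ltr_wpDr.
pose C3 := C' * beta ^+ 2 * (4 / del ^+ 2).
have C30 : 0 < C3.
  by apply: mulr_gt0; [apply: mulr_gt0 => //|apply: divr_gt0 => //]; exact: exprn_gt0.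
pose C4 := 2 * (C3 + 1) * (- ln c) + 4 * (1 + A1) * tau.
have e1 : 0 < 1 - theta - del by exact: aux1.
have e2 : 0 < (kappa + 1)^-1 by rewrite invr_gt0.
have e3 : 0 < eps - del by rewrite subr_gt0.
have [Y1 hY1] := expR_dominates (C3 + 1) e1.
have [Y2 hY2] := expR_dominates (2 * (1 + A1) * tau) e2.
have [Y3 hY3] := expR_dominates C4 e3.
exists (Num.max 0 (Num.max (K0.+1%:R / beta) (Num.max Y1 (Num.max Y2 Y3)))).
move=> n n0; set y := ln _; rewrite !ge_max => /and5P[y0 yK y1 y2 y3].
have nE : n%:R = expR y :> R by rewrite lnK// posrE ltr0n.
have by0 : 0 <= beta * y by rewrite mulr_ge0// ltW.
pose K := Num.truncn (beta * y).
have Kb : K%:R <= beta * y by rewrite truncn_le.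
have bK : beta * y < K%:R + 1 by rewrite natr1; exact: truncnS_gt.
have K0K : (K0 < K)%N.
  rewrite -ltnS -(ltr_nat R); apply: le_lt_trans (truncnS_gt _).
  by move: yK; rewrite ler_pdivrMr// mulrC.
have KltE : lt * (beta * y) = (kappa + 1)^-1 * y.
  by rewrite /beta; field; rewrite !gt_eqF.
have tE : tau ^+ K = expR (lt * K%:R).
  by rewrite expRM_natr /lt lnK// posrE.
have tK0 : 0 < tau ^+ K by rewrite exprn_gt0.
have tK : (tau ^+ K) `^ kappa <= expR (theta * y).
  rewrite tE -expRM ler_expR thetaE.
  have -> : kappa / (kappa + 1) * y = kappa * (lt * (beta * y)) by rewrite KltE; ring.
  by rewrite [_ * kappa]mulrC ler_pM2l// ler_pM2l.
(* Rounding [K] down costs at most one factor [tau]. *)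
have tKi : (tau ^+ K)^-1 <= tau * expR (- ((kappa + 1)^-1 * y)).
  have tauE : tau = expR lt by rewrite /lt lnK// posrE.
  rewrite tE -expRN tauE -expRD ler_expR -KltE.
  by rewrite -lerBlDl -opprD lerN2 -[X in _ + X]mulr1 -mulrDr ler_pM2l// ltW.
(* One length serves both purposes: [Ct] covers the distance of the trap, [M] the left wall. *)
pose z := C' * K%:R ^+ 2 * expR (theta * y).
have z0 : 0 <= z by rewrite !mulr_ge0 ?expR_ge0// ltW.
pose L := (Num.truncn z).+1.
have zL : z < L%:R by exact: truncnS_gt.
have Lz : L%:R <= z + 1 by rewrite /L -natr1 lerD2r truncn_le.
have K1 : 1 <= K%:R :> R by rewrite ler1n (leq_trans _ K0K).
have E1 : 1 <= expR (theta * y) by rewrite -expR0 ler_expR mulr_ge0// ltW.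
have LC : L%:R <= (C3 + 1) * expR ((theta + del) * y).
  apply: le_trans Lz _; rewrite mulrDl mul1r; apply: lerD; last first.
    by rewrite -expR0 ler_expR mulr_ge0// addr_ge0// ltW.
  have -> : C3 * expR ((theta + del) * y) =
      C' * (beta ^+ 2 * (4 / del ^+ 2 * expR (del * y))) * expR (theta * y).
    by rewrite mulrDl expRD /C3; ring.
  rewrite /z ler_pM2r ?expR_gt0// ler_pM2l//.
  apply: le_trans (_ : (beta * y) ^+ 2 <= _).
    by rewrite lerXn2r ?nnegrE.
  by rewrite exprMn ler_pM2l ?exprn_gt0//; exact: sqr_le_expR.
have Ln : (L <= n)%N.
  rewrite -(ler_nat R) nE; apply: le_trans LC _.
  have -> : expR y = expR ((1 - theta - del) * y) * expR ((theta + del) * y).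
    by rewrite -expRD -mulrDl; congr expR; ring.
  by rewrite ler_pM2r ?expR_gt0//; exact: hY1.
have [x [k [xk hprod]]] := trap K (ltnW K0K).
have xkL : (x + k < L)%N.
  rewrite -(ltr_nat R); apply: le_lt_trans zL; apply: le_trans xk _.
  apply: ler_pM; rewrite ?powR_ge0//; first by rewrite mulr_ge0// ltW.
  by rewrite ler_wpM2r// lerDl.
have MKL : (M * K <= L)%N.
  rewrite -(ler_nat R) natrM; apply: le_trans (ltW zL).
  rewrite /z; apply: le_trans (_ : C' * K%:R ^+ 2 <= _).
    rewrite expr2 mulrA; apply: le_trans (_ : C' * K%:R <= _).
      by rewrite ler_wpM2r// lerDr ltW.
    by rewrite ler_peMr// mulr_ge0// ltW.
  by rewrite ler_peMr// mulr_ge0// ltW.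
pose d := (1 + A1) * (tau ^+ K)^-1.
have dq : (tau ^+ K)^-1 + A1 * q ^+ L <= d.
  rewrite /d mulrDl mul1r lerD2l ler_pM2l//.
  apply: le_trans (_ : q ^+ (M * K) <= _).
    by apply: ler_wiXn2l; rewrite ?(ltW q0) ?(ltW q1).
  rewrite exprM -exprVn lerXn2r// nnegrE ?invr_ge0 ?exprn_ge0// ltW//.
have A11 : 0 < 1 + A1 by rewrite addr_gt0.
have d_ge0 : 0 <= d by apply: mulr_ge0; rewrite ?invr_ge0; exact: ltW.
have dE : d <= (1 + A1) * tau * expR (- ((kappa + 1)^-1 * y)).
  by rewrite -mulrA ler_pM2l.
have d_le : d <= 2^-1.
  apply: le_trans dE _; rewrite expRN ler_pdivrMr ?expR_gt0//.
  by apply: aux2; exact: hY2.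
have [d_le1 dd] := aux3 d d_le.
have := low d (tau ^+ K) n L x k tK0 xkL Ln hprod dq d_le1.
rewrite -ler_ln ?posrE ?return_prob_even_gt0 ?mulr_gt0 ?exprn_gt0//.
have -> : ln (c ^+ (2 * L) * (1 - d) ^+ (2 * n)) =
    (2 * L)%:R * ln c + (2 * n)%:R * ln (1 - d).
  by rewrite lnM ?posrE ?exprn_gt0// !lnXn// !mulr_natl.
move=> hlow.
have hd : - (2 * d) <= ln (1 - d) by apply: ln_1B_ge; rewrite d_ge0.
have n0' : 0 <= (2 * n)%:R :> R by rewrite ler0n.
have hnd := ler_wpM2l n0' hd.
have nd : n%:R * d <= (1 + A1) * tau * expR ((theta + del) * y).
  rewrite nE; apply: le_trans (ler_wpM2l (expR_ge0 _) dE) _.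
  rewrite mulrCA ler_pM2l ?mulr_gt0// -expRD ler_expR.
  have -> : y - (kappa + 1)^-1 * y = theta * y.
    by rewrite thetaE; field; rewrite gt_eqF.
  by rewrite ler_wpM2r// lerDl ltW.
have hL : (2 * L)%:R * - ln c <= 2 * (C3 + 1) * - ln c * expR ((theta + del) * y).
  rewrite natrM -[leRHS]mulrAC ler_pM2r// -mulrA ler_pM2l//.
apply: le_trans (_ : C4 * expR ((theta + del) * y) <= _).
  have -> : C4 * expR ((theta + del) * y) =
      2 * (C3 + 1) * - ln c * expR ((theta + del) * y) +
      4 * ((1 + A1) * tau) * expR ((theta + del) * y) by rewrite /C4; ring.
  by move: hlow hnd nd hL; rewrite !natrM; exact: aux4.
have -> : (theta + eps) * y = (eps - del) * y + (theta + del) * y by ring.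
by rewrite expRD ler_pM2r ?expR_gt0//; exact: hY3.
Qed.

End asymptotics.

Theorem lemma2p4 (R : realType) (P : probability (env_space R) R)
    (Pq : environment R -> probability traj_space R)
    (hPq : forall w : environment R, is_quenched_law w (Pq w))
    (hiid : iid P (fun (x : int) (w : environment R) => w x))
    (hell : exists2 c : R, 0 < c & forall x : int,
       P [set w : environment R | c <= w x <= 1 - c] = 1%E)
    (hlog : ('E_P[fun w : environment R => (ln (rho w 0))%R] < 0)%E)
    (hlt : (0 < P [set w : environment R | (w 0 < 2^-1)%R])%E)
    (hgt : (0 < P [set w : environment R | (2^-1 < w 0)%R])%E)
    (kappa : R) (kappa_gt0 : 0 < kappa)
    (hkappa : ('E_P[fun w : environment R => (rho w 0 `^ kappa)%R] = 1)%E) :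
  {ae P, forall w : environment R,
    ln (- ln (fine (Pq w [set X : trajectory | X (2 * n)%N = 0]))) / ln n%:R
      @[n --> \oo] --> kappa / (kappa + 1)}.
Proof.
have [c c_gt0 hc] := hell.
(* Countably many exponents decreasing to [kappa^-1], so that one null set serves every [eps]. *)
pose bs (j : nat) : R := kappa^-1 + j.+1%:R^-1.
have bs_gt j : kappa^-1 < bs j by rewrite ltrDl invr_gt0 ltr0n.
have profiles : {ae P, forall w : environment R, forall j : nat,
    exists r C m, barrier_profile w (bs j) r C m}.
  by apply: ae_foralln => j; exact: (barrier_profile_ae hiid kappa_gt0 hkappa hlt (bs_gt j)).
have [tau [Ct [tau1 Ct0 traps]]] := trap_ae hiid kappa_gt0 hkappa hlt c_gt0 hc.
apply: ae_imply (ae_conj (ellipticity_ae hc) (ae_conj profiles traps)).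
move=> w [cw [prof [K0 trap]]].
have -> : (fun n : nat =>
    ln (- ln (fine (Pq w [set X : trajectory | X (2 * n)%N = 0]))) / ln n%:R) =
    (fun n : nat => ln (- ln (return_prob w (2 * n) 0)) / ln n%:R).
  by apply/funext => n; rewrite (quenched_return _ (hPq w)).
apply: (@ln_ratio_cvg R (fun n => - ln (return_prob w (2 * n) 0))) => eps eps0.
have bs_small b : kappa^-1 < b -> exists b', kappa^-1 < b' <= b /\
    exists r C m, barrier_profile w b' r C m.
  move=> kb; have b0 : 0 < b - kappa^-1 by rewrite subr_gt0.
  pose j := Num.truncn (b - kappa^-1)^-1.
  exists (bs j); split; last exact: prof.
  rewrite bs_gt /= /bs -lerBrDl invf_ple ?posrE ?ltr0n//.
  exact/ltW/truncnS_gt.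
have [Y1 h1] := log_return_prob_ge c_gt0 cw kappa_gt0 erefl eps0 bs_small.
have b00 : 0 < bs 0%N by apply: lt_trans (bs_gt 0%N); rewrite invr_gt0.
have [Y2 h2] := log_return_prob_le c_gt0 cw kappa_gt0 erefl eps0 b00 (prof 0%N) tau1 Ct0 trap.
exists (Num.max Y1 Y2) => n n0; rewrite ge_max => /andP[y1 y2].
by rewrite h1// h2.
Qed.
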